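(* Let $(a_n)_{n\ge1}$ be a sequence of positive integers such that $\lim_{n\to\infty}\frac{\log(a_{n+1}/a_n)}{\log n}=\infty$. Then for Lebesgue almost every real $\alpha$ and for every real $\nu\ge1$, $$\dim_H\left\{\xi\in\mathbb{R}: \|a_n\alpha-\xi\|<\frac{1}{n^\nu}\text{ for infinitely many }n\ge1\right\}=\frac1\nu,$$ and $$\dim_H\left\{\xi\in K: \|a_n\alpha-\xi\|<\frac{1}{n^\nu}\text{ for infinitely many }n\ge1\right\}=\frac1\nu+\kappa-1$$ if this value is nonnegative; otherwise the latter set is empty.
   Context: $\|\cdot\|$ denotes the distance to the nearest integer. $K$ is the middle-third Cantor set $\{\sum_{i\ge1}a_i3^{-i}: a_i\in\{0,2\}\}$ and $\kappa=\log2/\log3$. $\dim_H$ is Hausdorff dimension. *)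

(* Defs.v *)
From mathcomp Require Import all_boot all_algebra all_classical all_reals all_analysis.
Import GRing.Theory Num.Theory numFieldNormedType.Exports.
Local Open Scope classical_set_scope.
Local Open Scope ring_scope.

Definition dist_int {R : realType} (x : R) : R :=
  Num.min (x - (Num.floor x)%:~R) ((Num.ceil x)%:~R - x).

(* diameter of a subset of R (-oo for the empty set) *)
Definition diam {R : realType} (A : set R) : \bar R :=
  ereal_sup [set (`|x - y|)%:E | x in A & y in A].

Definition diam_pow {R : realType} (s : R) (A : set R) : \bar R :=
  if asbool (A = set0) then 0%E else ((diam A) `^ s)%E.

Definition hausdorff_content {R : realType} (s delta : R) (E : set R) : \bar R :=
  ereal_inf [set (\sum_(0 <= i <oo) diam_pow s (U i))%E
            | U in [set U : nat -> set R |
                     E `<=` \bigcup_i U i /\ (forall i, (diam (U i) <= delta%:E)%E)]].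

Definition hausdorff_measure {R : realType} (s : R) (E : set R) : \bar R :=
  ereal_sup [set hausdorff_content s delta E | delta in [set d : R | 0 < d]].

Definition hausdorff_dim {R : realType} (E : set R) : \bar R :=
  ereal_inf [set s%:E | s in [set s : R | 0 <= s /\ hausdorff_measure s E = 0%E]].

Definition cantor_set {R : realType} : set R :=
  [set x : R | exists a : nat -> nat, (forall i, a i = 0%N \/ a i = 2%N) /\
      ((fun n : nat => \sum_(1 <= i < n) (a i)%:R / (3%:R : R) ^+ i) @ \oo --> x)].

Definition kappa {R : realType} : R := ln (2%:R : R) / ln (3%:R : R).

Definition W_set {R : realType} (a : nat -> nat) (alpha nu : R) : set R :=
  [set xi | forall N : nat, exists n : nat, (N <= n)%N /\ (1 <= n)%N /\
      dist_int ((a n)%:R * alpha - xi) < 1 / (n%:R `^ nu)].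

(* Main.v *)
(* Upper bounds.  Covering by the intervals of radius n^(-nu) around a_n alpha + k gives 1/nu
   for every alpha.  In the Cantor set K only the n for which a_n alpha comes within n^(-nu)
   of K + Z matter; this has probability of order n^(-nu (1 - kappa)), so for almost every
   alpha the sum of n^(-nu s) over these n is finite as soon as nu (s + 1 - kappa) > 1, and
   s = 0 gives emptiness when 1/nu + kappa - 1 < 0.

   Lower bounds.  Both R and K contain sets of numbers with triadic digits in a set D of
   3^delta digits.  Since a_(n+1) / a_n exceeds every power of n, the points a_n alpha mod 1
   with M <= n < 2M, where 3^L is about (2M)^nu, have the exponential moments of independent
   uniform points up to a constant factor.  Chernoff bounds then show that, with probability
   tending to 1 as L grows, these points visit the cells of the D-words of length L extending
   a fixed word, and do so evenly at every intermediate scale, up to the exponent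
   1/nu + delta - 1.  Hence almost surely every D-word has such a well spread family of
   extensions for arbitrarily large L.  Given any cover of small s-dimensional sum, an
   averaging argument picks extensions step by step that avoid the cover; the limit point is
   in the limsup set but not covered. *)

Require Import Defs.
From mathcomp Require Import all_boot all_order all_algebra all_classical all_reals all_analysis.
From mathcomp Require Import measurable_realfun zify ring lra.
Import Order.TTheory GRing.Theory Num.Theory numFieldNormedType.Exports.
Local Open Scope classical_set_scope.
Local Open Scope ring_scope.
Set Implicit Arguments.
Unset Strict Implicit.
Unset Printing Implicit Defensive.

(** * Triadic words *)

Lemma big_nat_mul_block (T : Type) (idx : T) (op : Monoid.law idx) (m q : nat) (F : nat -> T) :
  \big[op/idx]_(0 <= k < m * q) F k =
  \big[op/idx]_(0 <= i < m) \big[op/idx]_(0 <= r < q) F (i * q + r)%N.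
Proof.
elim: m => [|m IH]; first by rewrite mul0n !big_geq.
rewrite big_nat_recr //= mulSnr -IH (big_cat_nat (n := (m * q)%N)) //=; last exact: leq_addr.
by congr (op _ _); rewrite -{1}[(m * q)%N]add0n big_addn addKn; apply: eq_bigr => i _; rewrite addnC.
Qed.

(* [k < 3 ^ L] codes the triadic word of length [L] whose last letter is [k %% 3];
   [adm D L k] says that all its letters lie in [D]. *)
Fixpoint adm (D : pred nat) (L k : nat) : bool :=
  if L is L'.+1 then adm D L' (k %/ 3) && D (k %% 3)%N else k == 0%N.

Lemma adm_lt D L k : adm D L k -> (k < 3 ^ L)%N.
Proof.
elim: L k => [|L IH] k /=; first by move=> /eqP ->.
by move=> /andP[/IH + _]; rewrite ltn_divLR // expnSr.
Qed.

Lemma adm_anc D l j k : adm D (l + j) k -> adm D l (k %/ 3 ^ j).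
Proof.
elim: j k => [|j IH] k; first by rewrite addn0 divn1.
by rewrite addnS /= => /andP[/IH]; rewrite -divnMA expnS.
Qed.

(** An admissible word has one admissible child per letter of [D]; the induction splits a code
    [k = i * 3 + r] into its parent [i] and its last letter [r]. *)
Lemma count_adm (D : pred nat) (l j u : nat) : adm D l u ->
  (\sum_(0 <= k < 3 ^ (l + j)) (adm D (l + j) k && (k %/ 3 ^ j == u)) =
   (D 0 + D 1 + D 2) ^ j)%N.
Proof.
move=> Du; elim: j => [|j IH].
  rewrite addn0 expn0.
  under eq_bigr do rewrite divn1.
  rewrite (bigD1_seq u) ?iota_uniq ?mem_index_iota ?leq0n ?(adm_lt Du) // eqxx Du.
  by rewrite big1 // => i /negbTE iu; rewrite iu andbF.
rewrite addnS [in index_iota _ _]expnSr big_nat_mul_block [RHS]expnSr -IH big_distrl /=.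
apply: eq_bigr => i _.
have E r : (r < 3)%N -> ((i * 3 + r) %/ 3 = i)%N /\ ((i * 3 + r) %% 3 = r)%N.
  by move=> r3; rewrite divnMDl // modnMDl divn_small // modn_small // addn0.
transitivity (\sum_(0 <= r < 3) (adm D (l + j) i && (i %/ 3 ^ j == u)) * D r)%N.
  apply: eq_big_nat => r /andP[_ /E[E1 E2]].
  by rewrite expnS divnMA E1 E2 andbAC mulnb.
by rewrite -big_distrr /= !big_nat_recr //= big_geq.
Qed.

(* A pair (length, code) is a word; its prefix of length [l] has code [k %/ 3 ^ (L - l)]. *)
Definition anc (v w : nat * nat) : bool := (v.1 <= w.1)%N && (w.2 %/ 3 ^ (w.1 - v.1) == v.2)%N.

Lemma anc_trans v w x : anc v w -> anc w x -> anc v x.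
Proof.
move=> /andP[vw /eqP E1] /andP[wx /eqP E2]; apply/andP; split; first exact: leq_trans wx.
by rewrite -E1 -E2 -divnMA -expnD; apply/eqP; congr (_ %/ 3 ^ _)%N; lia.
Qed.

Lemma anc_linear v w x : (v.1 <= w.1)%N -> anc v x -> anc w x -> anc v w.
Proof.
move=> vw /andP[vx /eqP E1] /andP[wx /eqP E2]; rewrite /anc vw /= -E1 -E2 -divnMA -expnD.
by apply/eqP; congr (_ %/ 3 ^ _)%N; lia.
Qed.

Lemma anc_refl v : anc v v.
Proof. by rewrite /anc leqnn subnn divn1 eqxx. Qed.

Lemma anc_adm D v w : anc v w -> adm D w.1 w.2 -> adm D v.1 v.2.
Proof. by move=> /andP[vw /eqP <-]; rewrite -{1}(subnKC vw) => /adm_anc. Qed.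

(** * Paths avoiding a sparse set of words *)

Lemma nneseries_ge_term (R : realType) (f : nat -> R) i : (forall n, 0 <= f n) ->
  ((f i)%:E <= \sum_(n <oo) (f n)%:E)%E.
Proof.
move=> f0; apply: le_trans (nneseries_lim_ge i.+1 _); last by move=> n _ _; rewrite lee_fin.
by rewrite big_nat_recr //= leeDr // sume_ge0 // => n _; rewrite lee_fin.
Qed.

Lemma weight_ratio (F : numFieldType) (W x y n d : F) : x != 0 -> y != 0 -> d != 0 ->
  W * (n * (4 * d)^-1 / x) = 4^-1 * y * n * (W / (d * (x * y))).
Proof. by move=> x0 y0 d0; field; rewrite x0 y0 d0. Qed.

(* The mass distribution principle in combinatorial form: [spread] yields, below every
   admissible word, a family of good words that is uniformly spread at exponent [t'], and
   a sparse set of words at a larger [t] cannot block every path through such families. *)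
Section tree.
Variables (R : realType) (D : pred nat) (t' t C : R) (G : nat -> nat -> nat -> Prop).
Hypotheses (t'0 : 0 < t') (t't : t' < t) (C1 : 1 <= C).
Hypothesis Gmono : forall m n L k, (m <= n)%N -> G n L k -> G m L k.
Hypothesis spread : forall l k m0, adm D l k -> exists (L : nat) (V : seq nat),
  [/\ (l + m0 <= L)%N, (0 < size V)%N,
      forall m, m \in V -> [/\ adm D L m, anc (l, k) (L, m) & G m0 L m] &
      forall l' u, (l <= l')%N -> (l' <= L)%N ->
        (count (fun m => m %/ 3 ^ (L - l') == u)%N V)%:R <= C * t' ^+ (l' - l) * (size V)%:R].

(** This value gives [C * c = 1/4], so that each of the two kinds of charge in [tree_step] averages
    at most 1/4. *)
Let c := (4 * C)^-1.

Section step.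
Variable w : nat -> nat * nat.

Let S (v : nat * nat) := (\sum_(i <oo) (if anc v (w i) then t ^+ (w i).1 else 0)%:E)%E.

Let inv (v : nat * nat) :=
  [/\ adm D v.1 v.2, (S v <= (c * t ^+ v.1)%:E)%E & forall i, ~~ anc (w i) v].

Let t0 : 0 < t. Proof. exact: lt_trans t't. Qed.
Let C0 : 0 < C. Proof. exact: lt_le_trans C1. Qed.
Let c0 : 0 < c. Proof. by rewrite invr_gt0 mulr_gt0. Qed.

(* Averaging over the spread family [V]: [tau m i] charges 1 if [w i] is a new prefix
   of [m], and the normalised weight of [w i] if [w i] extends [m]; the mean charge is
   at most 1/2, and any [m] with total charge below 1 keeps the invariant. *)
Lemma tree_step v m0 : inv v -> exists v',
  [/\ inv v', anc v v', (v.1 < v'.1)%N & G m0 v'.1 v'.2].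
Proof.
case: v => l k [/= Dk Sv nw].
(* A jump of at least [m1] levels makes [C * (t' / t) ^ (L - l)] at most [C * c = 1/4], which pays
   for the constant [C] of the spread hypothesis. *)
have [m1 m1P] : exists m1, (t' / t) ^+ m1 <= c.
  have : (fun n => (t' / t) ^+ n) @ \oo --> (0 : R).
    apply: cvg_expr; rewrite ger0_norm ?divr_ge0 ?ltW //.
    by rewrite ltr_pdivrMr // mul1r.
  move=> /cvgr0_norm_le /(_ _ c0)[n _ /(_ n (leqnn n))] H; exists n.
  by apply: le_trans H; exact: ler_norm.
have [L [V [lL V0 VP cnt]]] := spread (maxn m0 m1).+1 Dk.
have ll : (l < L)%N by apply: leq_trans lL; rewrite addnS ltnS leq_addr.
have m1L : (m1 <= L - l)%N.
  rewrite leq_subRL ?(ltnW ll) //; apply: leq_trans lL.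
  by rewrite leq_add2l ltnW // ltnS leq_maxr.
pose N := (size V)%:R : R.
have N0 : 0 < N by rewrite ltr0n.
pose tau (m i : nat) : R :=
  (anc (l, k) (w i) && anc (w i) (L, m))%:R + (anc (L, m) (w i))%:R * t ^+ (w i).1 / (c * t ^+ L).
have tau0 m i : 0 <= tau m i.
  by rewrite addr_ge0 // !mulr_ge0 ?exprn_ge0 ?invr_ge0 ?mulr_ge0 ?exprn_ge0 // ltW.
(* Per unit of weight of [w i], the summand [C] bounds the charges for prefixes and [(4 * c)^-1] the
   charges for extensions. *)
pose beta := N * (C + (4 * c)^-1) / t ^+ l.
have tauV i : \sum_(m <- V) tau m i <= (if anc (l, k) (w i) then t ^+ (w i).1 else 0) * beta.
  rewrite /tau; case: ifPn => lw; last first.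
    rewrite mul0r big_seq big1 // => m mV /=.
    have [_ vm _] := VP _ mV; rewrite add0r.
    case: (boolP (anc (L, m) (w i))) => [mw|]; last by rewrite !mul0r.
    by rewrite (anc_trans vm mw) in lw.
  case wE : (w i) lw => [li ki] /= lw.
  have lli : (l <= li)%N by case/andP: lw.
  have tli : t ^+ li = t ^+ l * t ^+ (li - l) by rewrite -exprD subnKC.
  have tL : t ^+ L = t ^+ l * t ^+ (L - l) by rewrite -exprD subnKC // ltnW.
  have tl0 : t ^+ l != 0 by rewrite expf_neq0 // gt_eqF.
  rewrite big_split /= /beta mulrDr mulrDl mulrDr; apply: lerD.
    have -> : t ^+ li * (N * C / t ^+ l) = C * t ^+ (li - l) * N.
      by rewrite tli; move: (t ^+ l) tl0 => x x0; field.
    have [liL|Lli] := leqP li L; last first.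
      rewrite big1 ?mulr_ge0 ?exprn_ge0 ?(ltW t0) ?(ltW N0) ?(ltW C0) //.
      by move=> m _; rewrite /anc /= leqNgt Lli.
    apply: (@le_trans _ _ (C * t' ^+ (li - l) * N)); last first.
      rewrite ler_pM2r // ler_pM2l //; by apply: lerXn2r; rewrite ?nnegrE ?(ltW t'0) ?(ltW t0) ?(ltW t't).
    apply: le_trans (cnt li ki lli liL); rewrite -sum1_count natr_sum.
    rewrite [leRHS]big_mkcond /= ler_sum // => m _; rewrite /anc /= liL.
    by case: ifP.
  have Ct : C * t' ^+ (L - l) <= 4^-1 * t ^+ (L - l).
    have -> : t' ^+ (L - l) = (t' / t) ^+ (L - l) * t ^+ (L - l).
      by rewrite expr_div_n divfK // expf_neq0 // gt_eqF.
    rewrite mulrA ler_pM2r ?exprn_gt0 //.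
    apply: (@le_trans _ _ (C * c)); last first.
      by have -> : C * c = 4^-1; [rewrite /c; field; rewrite gt_eqF|].
    rewrite ler_pM2l //; apply: le_trans m1P; apply: ler_wiXn2l => //.
    - by rewrite divr_ge0 ?ltW.
    - by rewrite ler_pdivrMr // mul1r ltW.
  have -> : t ^+ li * (N * (4 * c)^-1 / t ^+ l) = 4^-1 * t ^+ (L - l) * N * (t ^+ li / (c * t ^+ L)).
    by rewrite tL; apply: weight_ratio; rewrite ?tl0 ?expf_neq0 // gt_eqF.
  rewrite -!mulr_suml -mulrA; apply: ler_wpM2r.
    by rewrite divr_ge0 ?mulr_ge0 ?exprn_ge0 ?ltW.
  apply: (@le_trans _ _ (C * t' ^+ (L - l) * N)); last by rewrite ler_pM2r.
  have [Lli|liL] := leqP L li; last first.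
    rewrite big1 ?mulr_ge0 ?exprn_ge0 ?ltW //.
    by move=> m _; rewrite /anc /= (leqNgt L) liL.
  (* Only members of [V] equal to the prefix of [w i] of length [L] are charged; the spread bound at
     the last level [L] limits their multiplicity. *)
  have := cnt L (ki %/ 3 ^ (li - L))%N (ltnW ll) (leqnn L).
  apply: le_trans; rewrite -sum1_count natr_sum [leRHS]big_mkcond /= ler_sum // => m _.
  by rewrite /anc /= Lli subnn divn1 eq_sym; case: ifP.
have beta0 : 0 <= beta.
  by rewrite /beta !mulr_ge0 ?addr_ge0 ?invr_ge0 ?exprn_ge0 ?mulr_ge0 ?ltW.
(* If every member of [V] were charged at least 1, the total charge would be at least [N], while the
   invariant at [(l, k)] limits it to [beta * c * t ^ l = N / 2]. *)
have [m mV mT] : exists2 m, m \in V & (\sum_(i <oo) (tau m i)%:E < 1)%E.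
  apply: contrapT => H.
  have T1 m : m \in V -> (1 <= \sum_(i <oo) (tau m i)%:E)%E.
    by move=> mV; rewrite leNgt; apply/negP => mT; apply: H; exists m.
  have : (N%:E <= \sum_(m <- V) \sum_(i <oo) (tau m i)%:E)%E.
    rewrite /N -sum1_size natr_sum -sumEFin !big_seq; apply: lee_sum => m mV.
    exact: T1.
  rewrite -nneseries_sum; last by move=> m i _; rewrite lee_fin.
  apply/negP; rewrite -ltNge.
  apply: (@le_lt_trans _ _ (beta%:E * S (l, k))%E).
    rewrite /S -nneseriesZl; last by move=> i _; rewrite lee_fin; case: ifP => // _; rewrite exprn_ge0 // ltW.
    apply: lee_nneseries => i _; last by rewrite sumEFin -EFinM lee_fin mulrC.
    by rewrite sume_ge0 // => m _; rewrite lee_fin.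
  apply: (@le_lt_trans _ _ (beta%:E * (c * t ^+ l)%:E)%E); first by rewrite lee_wpmul2l.
  rewrite -EFinM lte_fin.
  have -> : beta * (c * t ^+ l) = N / 2.
    have tl0 : t ^+ l != 0 by rewrite expf_neq0 // gt_eqF.
    have C0' : C != 0 by rewrite gt_eqF.
    by rewrite /beta /c; move: (t ^+ l) tl0 => x x0; field; rewrite x0 C0'.
  by rewrite ltr_pdivrMr // ltr_pMr // ltr1n.
have [Dm vm Gm] := VP _ mV.
have taum i : tau m i < 1.
  by rewrite -lte_fin; apply: le_lt_trans mT; exact: nneseries_ge_term.
exists (L, m); split=> //; last by apply: Gmono Gm; rewrite ltnW // ltnS leq_maxl.
split=> //=.
  have Sm : ((c * t ^+ L)^-1%:E * S (L, m) <= \sum_(i <oo) (tau m i)%:E)%E.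
    rewrite /S -nneseriesZl; last by move=> i _; rewrite lee_fin; case: ifP => // _; rewrite exprn_ge0 // ltW.
    apply: lee_nneseries => i _.
      by rewrite -EFinM lee_fin mulr_ge0 ?invr_ge0 ?mulr_ge0 ?exprn_ge0 ?(ltW c0) ?(ltW t0) //; case: ifP => // _; rewrite exprn_ge0 // ltW.
    rewrite -EFinM lee_fin /tau; case: ifP => _; last by rewrite mulr0 !mul0r addr0.
    by rewrite mul1r [leLHS]mulrC lerDr.
  have cL : 0 < c * t ^+ L by rewrite mulr_gt0 // exprn_gt0.
  have := le_trans Sm (ltW mT); by rewrite muleC lee_pdivrMr // mul1e.
move=> i; apply/negP => wm.
have [lw|wl] := leqP l (w i).1.
  have := taum i; rewrite /tau wm (anc_linear _ vm wm) // ltNge lerDl.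
  by rewrite !mulr_ge0 ?invr_ge0 ?mulr_ge0 ?exprn_ge0 // ltW.
by have := nw i; rewrite (anc_linear _ wm vm) //= ltnW.
Qed.

Lemma tree_path : (\sum_(i <oo) (t ^+ (w i).1)%:E <= c%:E)%E ->
  exists x : nat -> nat * nat, forall j,
    [/\ adm D (x j).1 (x j).2, anc (x j) (x j.+1), ((x j).1 < (x j.+1).1)%N,
        G j (x j.+1).1 (x j.+1).2 & forall i, ~~ anc (w i) (x j)].
Proof.
move=> wc.
have inv0 : inv (0%N, 0%N).
  split=> //=.
    rewrite expr0 mulr1; apply: le_trans wc; apply: lee_nneseries => i _.
      by rewrite lee_fin; case: ifP => // _; rewrite exprn_ge0 // ltW.
    by rewrite lee_fin; case: ifP => // _; rewrite exprn_ge0 // ltW.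
  (* An empty [w i] would have weight 1, above the total allowance [c <= 1/4]. *)
  move=> i; apply/negP => /andP[/=]; rewrite leqn0 => /eqP wi _.
  have := le_trans (@nneseries_ge_term R (fun i => t ^+ (w i).1) i (fun n => exprn_ge0 _ (ltW t0))) wc.
  have C4 : 1 < 4 * C by rewrite (@lt_le_trans _ _ 4) ?ltr1n // ler_peMr.
  by rewrite wi expr0 lee_fin /c leNgt invf_lt1 ?mulr_gt0 // C4.
pose T := {v | inv v}.
have step (p : nat * T) : exists q : nat * T,
  [/\ q.1 = p.1.+1, anc (sval p.2) (sval q.2), ((sval p.2).1 < (sval q.2).1)%N &
     G p.1 (sval q.2).1 (sval q.2).2].
  case: p => j [v vinv] /=; have [v' [iv' H1 H2 H3]] := tree_step j vinv.
  by exists (j.+1, exist _ v' iv').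
have [f fP] := choice step.
pose y := fix y j := if j is j'.+1 then f (y j') else (0%N, exist _ _ inv0 : T).
have y1 j : (y j).1 = j by elim: j => //= j {2}<-; case: (fP (y j)).
exists (fun j => sval (y j).2) => j.
have [_ H1 H2 H3] := fP (y j); rewrite y1 in H3.
by have [Dy _ nwy] := svalP (y j).2; split.
Qed.
End step.

Lemma tree_avoid : exists2 c, 0 < c & forall w : nat -> nat * nat,
  (\sum_(i <oo) (t ^+ (w i).1)%:E <= c%:E)%E ->
  exists x : nat -> nat * nat, forall j,
    [/\ adm D (x j).1 (x j).2, anc (x j) (x j.+1), ((x j).1 < (x j.+1).1)%N,
        G j (x j.+1).1 (x j.+1).2 & forall i, ~~ anc (w i) (x j)].
Proof.
by exists c; [rewrite invr_gt0 mulr_gt0 // (lt_le_trans _ C1)|move=> w /tree_path; exact].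
Qed.
End tree.

(** * Quasi-independence of the points a_n x modulo 1 *)

(** For [q = 3 ^ L] this is the code of the first [L] triadic digits of the fractional part of
    [y]. *)
Definition residue {R : realType} (q : nat) (y : R) : nat :=
  `|(Num.floor (q%:R * y) %% q%:Z)%Z|%N.

Lemma residue_eq (R : realType) q (y : R) (P : int) (i : nat) : (0 < q)%N ->
  P%:~R * q%:R + i%:R <= q%:R * y < P%:~R * q%:R + i%:R + 1 -> residue q y = (i %% q)%N.
Proof.
move=> q0 H; rewrite /residue (@floor_def _ _ (P * q%:Z + i%:Z)).
  by rewrite modzMDl modz_nat.
by rewrite !intrD intrM.
Qed.

Lemma measurable_floor (R : realType) (h : int -> R) :
  measurable_fun [set: R] (fun x => h (Num.floor x)).
Proof.
move=> _ Y mY; rewrite setTI.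
have -> : (fun x : R => h (Num.floor x)) @^-1` Y =
    \bigcup_(z : int) (if asbool (Y (h z)) then `[z%:~R, (z + 1)%:~R[%classic else set0).
  apply/seteqP; split=> x /=.
    move=> Yx; exists (Num.floor x) => //; case: asboolP => // _.
    by rewrite /= in_itv /= floor_itv.
  move=> [z _]; case: asboolP => // Yz; rewrite /= in_itv /= => /floor_def E.
  by rewrite E.
apply: countable_bigcupT_measurable; first exact: countableP.
by move=> z; case: ifP => // _; exact: measurable_itv.
Qed.

Lemma measurable_residue (R : realType) (g : nat -> R) (q : nat) (c : R) :
  measurable_fun [set: R] (fun x => g (residue q (c * x))).
Proof.
have := @measurable_floor R (fun z => g `|(z %% q%:Z)%Z|%N).
have : measurable_fun [set: R] (fun x : R => q%:R * (c * x)).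
  by apply: measurable_funM => //; apply: measurable_funM.
by move=> /[swap] /measurableT_comp /[apply].
Qed.

Lemma integral_itv_split (R : realType) (F : R -> R) (c h : R) (N : nat) :
  0 <= h -> measurable_fun [set: R] F -> (forall x, 0 <= F x) ->
  (\int[lebesgue_measure]_(x in `[c, (c + N%:R * h)%R[) (F x)%:E =
   \sum_(0 <= i < N) \int[lebesgue_measure]_(x in `[(c + i%:R * h)%R, (c + i.+1%:R * h)%R[) (F x)%:E)%E.
Proof.
move=> h0 mF F0; elim: N => [|N IH].
  by rewrite mul0r addr0 set_itvco0 integral_set0 big_geq.
rewrite big_nat_recr //= -IH -ge0_integral_setU //=.
- congr (integral _ _ _); apply/seteqP; split=> x /=; rewrite !in_itv /=.
    by case: (ltP x (c + N%:R * h)) => [_ /andP[-> _]|_ /andP[_ ->]]; [left|right].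
  rewrite -natr1; have : 0 <= N%:R * h by rewrite mulr_ge0.
  by move=> Nh [] /andP[H1 H2]; apply/andP; split; lra.
- by apply/measurable_EFinP; apply: measurable_funS mF.
- by move=> x _; rewrite lee_fin.
- rewrite disj_set2E; apply/eqP/seteqP; split=> x //=; rewrite !in_itv /=.
  by move=> [/andP[_ H1] /andP[H2 _]]; lra.
Qed.

(* [g] only depends on the cell of length [1 / (q * a)] containing [x], and each such cell
   is long for [F]; cover the interval by whole periods of [x |-> a * x] modulo 1. *)
Lemma integral_step (R : realType) (F : R -> R) (g : nat -> R) (q : nat) (a Q H b l : R) :
  (0 < q)%N -> 0 < a -> 0 < Q -> Q <= l * a -> 0 <= H ->
  measurable_fun [set: R] F -> (forall x, 0 <= F x) -> (forall i, 0 <= g i) ->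
  (forall c, (\int[lebesgue_measure]_(x in `[c, (c + (q%:R * a)^-1)%R[) (F x)%:E <=
     ((q%:R * a)^-1 * H)%:E)%E) ->
  (\int[lebesgue_measure]_(x in `[b, (b + l)%R[) (g (residue q (a * x)) * F x)%:E <=
    (l * (((1 + 2 / Q) * ((\sum_(0 <= r < q) g r) / q%:R)) * H))%:E)%E.
Proof.
move=> q0 a0 Q0 Ql H0 mF F0 g0 FH.
have qR : 0 < q%:R :> R by rewrite ltr0n.
pose h := (q%:R * a)^-1; have h0 : 0 < h by rewrite invr_gt0 mulr_gt0.
(* The periods of length [1 / a] starting at [P / a] cover the interval once there are two more than
   the whole part of [a * l]; since [Q <= l * a], the surplus costs the factor [1 + 2 / Q]. *)
pose P := Num.floor (a * b).
pose m := (Num.truncn (a * l)).+2.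
have la0 : 0 <= a * l by rewrite mulrC; lra.
have /andP[tl tu] := truncn_itv la0.
have /andP[Pl Pu] := floor_itv (a * b).
have mG : measurable_fun [set: R] (fun x => g (residue q (a * x)) * F x).
  by apply: measurable_funM => //; exact: measurable_residue.
have G0 x : 0 <= g (residue q (a * x)) * F x by rewrite mulr_ge0.
pose c := P%:~R / a.
apply: (@le_trans _ _ (\int[lebesgue_measure]_(x in `[c, (c + (m * q)%:R * h)%R[)
    (g (residue q (a * x)) * F x)%:E)%E).
  apply: ge0_subset_integral => //.
  - by apply/measurable_EFinP; apply: measurable_funS mG.
  - by move=> x _; rewrite lee_fin.
  move=> x /=; rewrite !in_itv /= => /andP[bx xb]; apply/andP; split.
    by apply: le_trans bx; rewrite /c ler_pdivrMr // mulrC.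
  apply: (lt_le_trans xb).
  have -> : c + (m * q)%:R * h = (P%:~R + m%:R) / a.
    by rewrite /c /h natrM; field; rewrite !gt_eqF.
  rewrite ler_pdivlMr // /m -[_.+2]addn1 natrD.
  move: Pu; rewrite intrD => Pu; rewrite mulrDl ![_ * a]mulrC; lra.
rewrite (integral_itv_split _ _ (ltW h0) mG G0).
(* On the [i]-th cell of length [h] the residue is constantly [i %% q], so [g] comes out of the
   integral and [FH] bounds the rest. *)
apply: (@le_trans _ _ (\sum_(0 <= i < m * q) (g (i %% q)%N * (h * H))%:E)%E).
  rewrite big_nat [leRHS]big_nat; apply: lee_sum => i /andP[_ imq].
  rewrite [leLHS](_ : _ = \int[lebesgue_measure]_(x in `[(c + i%:R * h)%R, (c + i.+1%:R * h)%R[)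
      ((g (i %% q)%N)%:E * (F x)%:E))%E; last first.
    apply: eq_integral => x; rewrite inE /= in_itv /= => /andP[x1 x2]; rewrite -EFinM; congr (g _ * _)%:E.
    apply: (@residue_eq _ _ _ P) => //.
    have E (j : nat) : c + j%:R * h = (P%:~R * q%:R + j%:R) / (q%:R * a).
      by rewrite /c /h; field; rewrite !gt_eqF.
    move: x1 x2; rewrite !E ler_pdivrMr ?mulr_gt0 // ltr_pdivlMr ?mulr_gt0 // => x1 x2.
    rewrite (_ : q%:R * (a * x) = x * (q%:R * a)); last by ring.
    by rewrite x1 /=; move: x2; rewrite -natr1 addrA.
  rewrite ge0_integralZl_EFin //; last 2 first.
  - by move=> x _; rewrite lee_fin.
  - by apply/measurable_EFinP; apply: measurable_funS mF.
  rewrite EFinM lee_wpmul2l ?lee_fin //.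
  have -> : c + i.+1%:R * h = c + i%:R * h + h by rewrite -natr1 mulrDl mul1r addrA.
  exact: FH.
rewrite sumEFin lee_fin -mulr_suml big_nat_mul_block /=.
under eq_bigr => i _.
  under eq_big_nat => r /andP[_ rq] do rewrite modnMDl modn_small //.
  over.
rewrite sumr_const_nat subn0.
set s := \sum_(0 <= r < q) g r.
have s0 : 0 <= s by apply: sumr_ge0.
have -> : l * ((1 + 2 / Q) * (s / q%:R) * H) = l * (1 + 2 / Q) * (s / q%:R * H) by ring.
have -> : s *+ m * (h * H) = (m%:R / a) * (s / q%:R * H).
  by rewrite -mulr_natr /h; field; rewrite !gt_eqF.
apply: ler_wpM2r; first by rewrite mulr_ge0 // divr_ge0 // ltW.
rewrite ler_pdivrMr // /m -[_.+2]addn2 natrD.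
have -> : l * (1 + 2 / Q) * a = l * a + 2 * (l * a / Q) by field; rewrite gt_eqF.
have : 1 <= l * a / Q by rewrite ler_pdivlMr // mul1r.
have : (Num.truncn (a * l))%:R <= l * a by rewrite [leRHS]mulrC.
lra.
Qed.

(* Lacunarity makes the fractional parts of [a j * x] behave as if they were independent. *)
Lemma integral_prod (R : realType) (g : nat -> R) (q : nat) (a : nat -> nat) (Q : R) (k n : nat) (b l : R) :
  (0 < q)%N -> 0 < Q -> (forall i, 0 <= g i) ->
  (forall j, (n <= j)%N -> (0 < a j)%N) ->
  (forall j, (n <= j)%N -> Q * q%:R * (a j)%:R <= (a j.+1)%:R) ->
  0 <= l -> Q <= l * (a n)%:R ->
  (\int[lebesgue_measure]_(x in `[b, (b + l)%R[) (\prod_(n <= j < n + k) g (residue q ((a j)%:R * x)))%:E <=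
    (l * ((1 + 2 / Q) * ((\sum_(0 <= r < q) g r) / q%:R)) ^+ k)%:E)%E.
Proof.
move=> q0 Q0 g0; elim: k n b l => [|k IH] n b l a0 aQ l0 Ql.
  under eq_integral do rewrite addn0 big_geq //.
  rewrite integral_cst //= mul1e expr0 mulr1 lebesgue_measure_itv /= lte_fin.
  case: ifP => _; last by rewrite lee_fin.
  by rewrite -EFinD lee_fin; lra.
under eq_integral do rewrite big_ltn ?addnS ?ltnS ?leq_addr // -addSn.
have an0 : 0 < (a n)%:R :> R by rewrite ltr0n a0.
have qR : 0 < q%:R :> R by rewrite ltr0n.
(* The first factor plays [g] and the product of the later ones plays [F]; the induction hypothesis
   applies on cells of length [1 / (q * a n)], which by [aQ] are long for [a n.+1]. *)
rewrite exprS; apply: integral_step => //.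
- rewrite exprn_ge0 // mulr_ge0 ?addr_ge0 ?divr_ge0 ?sumr_ge0 // ltW //.
- apply: measurable_prod => j _; exact: measurable_residue.
- by move=> x; rewrite prodr_ge0.
move=> c; apply: IH => //.
- by move=> j nj; apply: a0; exact: ltnW.
- by move=> j nj; apply: aQ; exact: ltnW.
rewrite ler_pdivlMl ?mulr_gt0 //; apply: le_trans (aQ n (leqnn n)).
by rewrite le_eqVlt; apply/orP; left; apply/eqP; ring.
Qed.

(** * Growth estimates, Markov's inequality, a criterion for almost every point *)

Lemma bernoulli_le (R : realDomainType) (x : R) n : 0 <= x -> 1 + n%:R * x <= (1 + x) ^+ n.
Proof.
move=> x0; elim: n => [|n IH]; first by rewrite mul0r addr0 expr0.
rewrite exprSr; apply: (@le_trans _ _ ((1 + n%:R * x) * (1 + x))).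
  have nx : 0 <= n%:R * x * x by rewrite !mulr_ge0.
  by rewrite -natr1; lra.
by rewrite ler_wpM2r // addr_ge0.
Qed.

Lemma near_expr_ge (R : realType) (b C : R) : 1 < b -> \forall n \near \oo, C <= b ^+ n.
Proof.
move=> b1; near=> n.
have nC : C / (b - 1) <= n%:R by near: n; exact: nbhs_infty_ger.
have b0 : 0 < b - 1 by rewrite subr_gt0.
apply: (@le_trans _ _ (1 + n%:R * (b - 1))).
  by move: nC; rewrite ler_pdivrMr //; lra.
by have := bernoulli_le n (ltW b0); rewrite subrKC.
Unshelve. all: by end_near. Qed.

Lemma near_expr_ge_linear (R : realType) (b C : R) : 1 < b -> \forall n \near \oo, C * n%:R <= b ^+ n.
Proof.
move=> b1; pose s := Num.sqrt b.
have s1 : 1 < s by rewrite -(@sqrtr1 R) ltr_sqrt // (lt_trans _ b1).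
have s0 : 0 < s - 1 by rewrite subr_gt0.
near=> n.
have sC : `|C| / (s - 1) <= s ^+ n by near: n; exact: near_expr_ge.
have -> : b = s * s by rewrite -expr2 sqr_sqrtr // ltW // (lt_trans _ b1).
rewrite exprMn; apply: (@le_trans _ _ (`|C| / (s - 1) * (n%:R * (s - 1)))).
  rewrite (_ : `|C| / (s - 1) * _ = `|C| * n%:R); last by field; rewrite gt_eqF.
  by rewrite ler_wpM2r // ler_norm.
apply: ler_pM => //.
- by rewrite divr_ge0 // ltW.
- by rewrite mulr_ge0 // ltW.
have := bernoulli_le n (ltW s0); rewrite subrKC; lra.
Unshelve. all: by end_near. Qed.

Lemma markov_itv (R : realType) (D : set R) (F : R -> R) (c B : R) :
  measurable D -> measurable_fun [set: R] F -> (forall x, 0 <= F x) -> 0 < c ->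
  (\int[lebesgue_measure]_(x in D) (F x)%:E <= B%:E)%E ->
  (lebesgue_measure (D `&` [set x | (c <= F x)%R]) <= (B / c)%:E)%E.
Proof.
move=> mD mF F0 c0 FB.
have mE : measurable_fun D (EFin \o F).
  by apply/measurable_EFinP; apply: measurable_funS mF.
have := @le_integral_comp_abse _ _ _ lebesgue_measure D mD (EFin \o F) c id
  (@measurable_id _ _ _) (fun r r0 => r0) (fun _ _ _ _ h => h) mE c0.
have -> : [set x | (c%:E <= `|(EFin \o F) x|)%E] = [set x | (c <= F x)%R].
  by apply/seteqP; split => x /=; rewrite lee_fin ger0_norm.
under eq_integral do rewrite /= ger0_norm //.
move=> /le_trans /(_ FB) H.
by rewrite EFinM lee_pdivlMr // muleC.
Qed.

(** On each [[-A, A)] the exceptional points lie in the intersection of the sets obtained for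
    [e = 1 / (n + 1)], which is null; countably many [A] exhaust the line. *)
Lemma ae_of_small_exceptions (R : realType) (P : R -> Prop) :
  (forall (A : nat) (e : R), 0 < e -> exists B : set R,
     [/\ measurable B, forall x, `[- A%:R, A%:R[%classic x -> ~ P x -> B x &
       (lebesgue_measure (`[(- A%:R)%R, A%:R%R[ `&` B) <= e%:E)%E]) ->
  {ae lebesgue_measure, forall x, P x}.
Proof.
move=> H; have H' (A n : nat) := H A n.+1%:R^-1 (ltac:(by rewrite invr_gt0)).
have {}H' A : {f : nat -> set R | forall n, [/\ measurable (f n),
    forall x, `[- A%:R, A%:R[%classic x -> ~ P x -> f n x &
    (lebesgue_measure (`[(- A%:R)%R, A%:R%R[ `&` f n) <= (n.+1%:R^-1)%:E)%E]}.
  by have [f fP] := choice (H' A); exists f.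
pose B A := sval (H' A).
have BP A n : [/\ measurable (B A n),
    forall x, `[- A%:R, A%:R[%classic x -> ~ P x -> B A n x &
    (lebesgue_measure (`[(- A%:R)%R, A%:R%R[ `&` B A n) <= (n.+1%:R^-1)%:E)%E] := svalP (H' A) n.
suff : lebesgue_measure.-negligible (\bigcup_A (\bigcap_n (`[- A%:R, A%:R[ `&` B A n))).
  apply: negligibleS => x /= nP; have [A xA] : exists A : nat, `|x| < A%:R.
    by exists (Num.truncn `|x|).+1; rewrite truncnS_gt.
  have xI : `[- A%:R, A%:R[%classic x.
    by move: xA; rewrite /= in_itv /= ltr_norml => /andP[/ltW -> ->].
  by exists A => // n _; split => //; have [_ + _] := BP A n; apply.
apply: negligible_bigcup => A.
have mB n : measurable (`[- A%:R, A%:R[ `&` B A n).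
  by apply: measurableI => //; have [] := BP A n.
apply/negligibleP; first exact: bigcapT_measurable.
apply/eqP; rewrite -measure_le0; apply/lee_addgt0Pr => e e0; rewrite add0e.
have [n ne] : exists n : nat, n.+1%:R^-1 <= e.
  exists (Num.truncn e^-1); rewrite invf_ple ?posrE // ltW // truncnS_gt //.
apply: (@le_trans _ _ (lebesgue_measure (`[- A%:R, A%:R[ `&` B A n))).
  by apply: le_measure; rewrite ?inE //; [exact: bigcapT_measurable|exact: mB|move=> x /(_ n I)].
by have [_ _ muB] := BP A n; apply: (le_trans muB); rewrite lee_fin.
Qed.

(** * Chernoff bounds for visits to cells *)

Lemma prod_if_count (F : pzRingType) (c : F) (I : Type) (P : pred I) (s : seq I) :
  \prod_(i <- s) (if P i then c else 1) = c ^+ count P s.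
Proof.
elim: s => [|i s IH]; first by rewrite big_nil.
by rewrite big_cons IH /=; case: (P i); rewrite ?exprS // mul1r.
Qed.

Lemma measure_bigsetU_le (R : realType) (I : eqType) (s : seq I) (J : set R) (E : I -> set R) (c : R) :
  measurable J -> (forall i, i \in s -> measurable (E i)) ->
  (forall i, i \in s -> (lebesgue_measure (J `&` E i) <= c%:E)%E) ->
  (lebesgue_measure (J `&` \big[setU/set0]_(i <- s) E i) <= ((size s)%:R * c)%:E)%E.
Proof.
move=> mJ; elim: s => [|i s IH] mE cE.
  by rewrite big_nil setI0 measure0 mul0r.
have mi : measurable (J `&` E i) by apply: measurableI => //; apply: mE; rewrite mem_head.
have ms : measurable (J `&` \big[setU/set0]_(j <- s) E j).
  apply: measurableI => //; rewrite big_seq; apply: bigsetU_measurable => j js.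
  by apply: mE; rewrite in_cons js orbT.
rewrite big_cons setIUr /= -nat1r mulrDl mul1r EFinD.
apply: (le_trans (measureU2 lebesgue_measure mi ms)); apply: leeD; first by apply: cE; rewrite mem_head.
by apply: IH => j js; [apply: mE|apply: cE]; rewrite in_cons js orbT.
Qed.

Definition desc (D : pred nat) (L l u r : nat) : bool := adm D L r && (r %/ 3 ^ (L - l) == u)%N.

Definition hits {R : realType} (D : pred nat) (a : nat -> nat) (M L l u : nat) (x : R) : nat :=
  count (fun j => desc D L l u (residue (3 ^ L) ((a j)%:R * x))) (index_iota M (M + M)).

Section hits.
Variables (R : realType) (D : pred nat) (a : nat -> nat) (M L : nat).
Hypotheses (M0 : (0 < M)%N) (a0 : forall j, (M <= j)%N -> (0 < a j)%N).
Hypothesis aM : forall j, (M <= j)%N -> (M + M)%:R * (3 ^ L)%:R * (a j)%:R <= (a j.+1)%:R :> R.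
Let d := (D 0 + D 1 + D 2)%N.
(** The expectation of [hits] for [M] independent uniform points: [d ^ (L - l)] of the [3 ^ L] cells
    count. *)
Let mean (l : nat) : R := M%:R * (d ^ (L - l))%:R / (3 ^ L)%:R.

Let q0 : 0 < (3 ^ L)%:R :> R. Proof. by rewrite ltr0n expn_gt0. Qed.

Lemma measurable_exp_hits (c : R) l u : measurable_fun [set: R] (fun x => c ^+ hits D a M L l u x).
Proof.
under eq_fun do rewrite /hits -prod_if_count.
by apply: measurable_prod => j _; exact: (@measurable_residue _ (fun r => if desc D L l u r then c else 1)).
Qed.

(** Quasi-independence with [Q = 2 * M] bounds the integral by [len] times the [M]-th power of
    [(1 + 1 / M) * (1 + (c - 1) * p)], with [p] the share of counted cells; by [1 + x <= exp x] the
    factors [1 + 1 / M] only add 1 to the exponent. *)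
Lemma integral_exp_hits (c b len : R) l u : 0 < c -> (l <= L)%N -> adm D l u ->
  0 <= len -> (M + M)%:R <= len * (a M)%:R ->
  (\int[lebesgue_measure]_(x in `[b, (b + len)%R[) (c ^+ hits D a M L l u x)%:E <=
   (len * expR (1 + (c - 1) * mean l))%:E)%E.
Proof.
move=> c0 lL Du len0 lenM.
have MR : 0 < M%:R :> R by rewrite ltr0n.
pose g r := if desc D L l u r then c else 1.
have g0 r : 0 <= g r by rewrite /g; case: ifP => _ //; exact: ltW.
under eq_integral do rewrite /hits -prod_if_count.
apply: le_trans (@integral_prod R g (3 ^ L)%N a (M + M)%:R M M b len _ _ g0 a0 aM len0 lenM) _.
- by rewrite expn_gt0.
- by rewrite ltr0n addn_gt0 M0.
rewrite lee_fin ler_wpM2l //.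
have sumg : \sum_(0 <= r < (3 ^ L)%N) g r = (3 ^ L)%:R + (c - 1) * (d ^ (L - l))%:R.
  have := @count_adm D l (L - l) u Du; rewrite subnKC // -/d => <-.
  have -> : (3 ^ L)%:R = \sum_(0 <= r < (3 ^ L)%N) (1 : R) by rewrite sumr_const_nat subn0.
  rewrite natr_sum mulr_sumr -big_split /=.
  by apply: eq_bigr => r _; rewrite /g /desc; case: ifP => _; rewrite ?mulr1 ?mulr0 ?addr0 ?subrKC.
set p := (d ^ (L - l))%:R / (3 ^ L)%:R : R.
have E : (\sum_(0 <= r < (3 ^ L)%N) g r) / (3 ^ L)%:R = 1 + (c - 1) * p.
  by rewrite sumg /p; field; rewrite gt_eqF.
have E0 : 0 <= 1 + (c - 1) * p by rewrite -E divr_ge0 ?sumr_ge0 // ltW.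
rewrite E; have -> : 2 / (M + M)%:R = M%:R^-1 :> R.
  by rewrite addnn -mul2n natrM invfM mulrA divff ?mul1r.
have -> : 1 + (c - 1) * mean l = M%:R * (M%:R^-1 + (c - 1) * p).
  by rewrite /mean /p mulrDr mulfV ?gt_eqF //; ring.
have M1 : 0 <= M%:R^-1 :> R by rewrite invr_ge0 ltW.
rewrite expRM_natl expRD; apply: lerXn2r; rewrite ?nnegrE.
- by rewrite mulr_ge0 // addr_ge0.
- by rewrite mulr_ge0 // expR_ge0.
by apply: ler_pM => //; rewrite ?expR_ge1Dx ?addr_ge0.
Qed.

(** Markov's inequality for the moment with [c = 2]: its exponent [1 + mean l] falls short of the
    threshold by at least [K - 1]. *)
Lemma hits_large (A K : R) l u : (l <= L)%N -> adm D l u -> 0 <= A ->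
  (M + M)%:R <= (A + A) * (a M)%:R ->
  (lebesgue_measure (`[(- A)%R, A%R[ `&`
     [set x | (expR (2 * mean l + K) <= 2 ^+ hits D a M L l u x)%R]) <=
   ((A + A) * expR (1 - K))%:E)%E.
Proof.
move=> lL Du A0 AM; have AA : `[- A, A[%classic = `[- A, - A + (A + A)[%classic :> set R.
  by rewrite addrA addNr add0r.
rewrite AA; have mean0 : 0 <= mean l by rewrite divr_ge0 ?mulr_ge0.
have i0 : 0 < 2 :> R by [].
apply: le_trans (markov_itv (measurable_itv _) (measurable_exp_hits _ _ _)
  (fun x => exprn_ge0 _ (ltW i0)) (expR_gt0 _)
  (integral_exp_hits (- A) i0 lL Du (addr_ge0 A0 A0) AM)) _.
rewrite lee_fin -mulrA -expRN -expRD ler_wpM2l ?addr_ge0 // ler_expR; lra.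
Qed.

(** Markov's inequality with [c = 1/2]: the moment has exponent [1 - mean l / 2], the threshold
    [- mean l / 4], and their gap [mean l / 4 - 1] is at least [K - 1]. *)
Lemma hits_small (A K : R) l u : (l <= L)%N -> adm D l u -> 0 <= A ->
  (M + M)%:R <= (A + A) * (a M)%:R -> K <= mean l / 4 ->
  (lebesgue_measure (`[(- A)%R, A%R[ `&`
     [set x | (expR (- (mean l / 4)) <= 2^-1 ^+ hits D a M L l u x)%R]) <=
   ((A + A) * expR (1 - K))%:E)%E.
Proof.
move=> lL Du A0 AM KM; have AA : `[- A, A[%classic = `[- A, - A + (A + A)[%classic :> set R.
  by rewrite addrA addNr add0r.
rewrite AA; have i0 : 0 < 2^-1 :> R by rewrite invr_gt0.
apply: le_trans (markov_itv (measurable_itv _) (measurable_exp_hits _ _ _)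
  (fun x => exprn_ge0 _ (ltW i0)) (expR_gt0 _)
  (integral_exp_hits (- A) i0 lL Du (addr_ge0 A0 A0) AM)) _.
rewrite lee_fin -mulrA -expRN -expRD ler_wpM2l ?addr_ge0 // ler_expR; lra.
Qed.
End hits.

Lemma expR_half_le2 (R : realType) : expR 2^-1 <= 2 :> R.
Proof.
have := @expR_ge1Dx R (- 2^-1); rewrite expRN => H.
have : 2^-1 <= (expR 2^-1)^-1 :> R by lra.
by rewrite lef_pV2 ?posrE ?expR_gt0.
Qed.

Lemma expR_le_exp2 (R : realType) (h : nat) : expR (h%:R / 2) <= 2 ^+ h :> R.
Proof.
rewrite expRM_natl; apply: lerXn2r; rewrite ?nnegrE ?expR_ge0 //; exact: expR_half_le2.
Qed.

Lemma expRN_le_exp_half (R : realType) (h : nat) : expR (- h%:R) <= 2^-1 ^+ h :> R.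
Proof.
rewrite -mulrN1 expRM_natl; apply: lerXn2r; rewrite ?nnegrE ?expR_ge0 ?invr_ge0 //.
by rewrite expRN lef_pV2 ?posrE ?expR_gt0 //; have := @expR_ge1Dx R 1; lra.
Qed.

(** * Evenly spread families of visited words *)

Section spread.
Variables (R : realType) (D : pred nat) (a : nat -> nat).
Let d := (D 0 + D 1 + D 2)%N.
Let mean (M L l : nat) : R := M%:R * (d ^ (L - l))%:R / (3 ^ L)%:R.

(* [B] is the union of the exceptional sets of the Chernoff bounds for the number of visits
   to [k] (too few) and to every admissible word of length at most [L] (too many). *)
Lemma atypical_set (M L l k : nat) (A K : R) :
  (0 < M)%N -> (forall j, (M <= j)%N -> (0 < a j)%N) ->
  (forall j, (M <= j)%N -> (M + M)%:R * (3 ^ L)%:R * (a j)%:R <= (a j.+1)%:R :> R) ->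
  (l <= L)%N -> adm D l k -> 0 <= A -> (M + M)%:R <= (A + A) * (a M)%:R -> K <= mean M L l / 4 ->
  exists B : set R, [/\ measurable B,
    (lebesgue_measure (`[(- A)%R, A%R[ `&` B) <=
       ((1 + L.+1%:R * (3 ^ L)%:R) * ((A + A) * expR (1 - K)))%:E)%E &
    forall x, ~ B x -> mean M L l / 4 < (hits D a M L l k x)%:R /\
      forall l' u, (l' <= L)%N -> adm D l' u -> (hits D a M L l' u x)%:R < 4 * mean M L l' + 2 * K].
Proof.
move=> M0 a0 aM lL Dk A0 AM KM.
pose E0 := [set x : R | expR (- (mean M L l / 4)) <= 2^-1 ^+ hits D a M L l k x].
pose E1 (p : nat * nat) := [set x : R | expR (2 * mean M L p.1 + K) <= 2 ^+ hits D a M L p.1 p.2 x].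
pose s := [seq (i, j) | i <- iota 0 L.+1, j <- [seq j <- iota 0 (3 ^ L) | adm D i j]].
have sz : (size s <= L.+1 * 3 ^ L)%N.
  rewrite /s size_allpairs_dep sumnE big_map (@leq_trans (\sum_(j <- iota 0 L.+1) 3 ^ L)%N) //.
    by apply: leq_sum => i _; rewrite size_filter (leq_trans (count_size _ _)) // size_iota.
  by rewrite big_const_seq count_predT size_iota iter_addn_0 mulnC.
have sP p : p \in s -> (p.1 <= L)%N /\ adm D p.1 p.2.
  move=> /allpairsPdep[i [j [iL]]]; rewrite mem_filter => /andP[Dj _] -> /=.
  by move: iL; rewrite mem_iota.
have mE c' i j (y : R) : measurable [set x : R | y <= c' ^+ hits D a M L i j x].
  rewrite -[X in measurable X]setTI.
  apply: (@measurable_fun_ler _ _ _ setT (cst y) (fun x => c' ^+ hits D a M L i j x)) => //.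
  exact: measurable_exp_hits.
exists (E0 `|` \big[setU/set0]_(p <- s) E1 p).
have mE0 : measurable E0 by exact: mE.
have mE1 : measurable (\big[setU/set0]_(p <- s) E1 p).
  by apply: bigsetU_measurable => p _; exact: mE.
have mI : measurable (`[- A, A[%classic : set R) by exact: measurable_itv.
split; first exact: measurableU.
  rewrite setIUr; apply: (le_trans (measureU2 lebesgue_measure (measurableI _ _ mI mE0) (measurableI _ _ mI mE1))).
  rewrite mulrDl mul1r EFinD; apply: leeD; first exact: hits_small.
  have H := @measure_bigsetU_le R _ s (`[- A, A[%classic) E1 ((A + A) * expR (1 - K)) mI.
  apply: (le_trans (H _ _)) => [p _|p /sP[pL Dp]|]; first exact: mE.
    exact: hits_large.
  by rewrite lee_fin ler_wpM2r -?natrM ?ler_nat // mulr_ge0 ?addr_ge0 ?expR_ge0.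
move=> x /not_orP[nE0 nE1]; split.
  (* The inequalities [exp (- h) <= 2 ^- h] here and [exp (h / 2) <= 2 ^ h] below turn the
     exponential thresholds into linear bounds on the number [h] of visits. *)
  move/negP: nE0; rewrite -ltNge => H.
  have := le_lt_trans (expRN_le_exp_half R (hits D a M L l k x)) H.
  by rewrite ltr_expR ltrN2.
move=> l' u l'L Du.
have ps : (l', u) \in s.
  apply/allpairsPdep; exists l', u; rewrite mem_iota mem_filter Du mem_iota /=; split => //.
  by rewrite (leq_trans (adm_lt Du)) // leq_pexp2l.
have nE : ~ E1 (l', u) x.
  by move=> Ex; apply: nE1; rewrite -bigcup_seq; exists (l', u).
move/negP: nE; rewrite -ltNge => H.
have := le_lt_trans (expR_le_exp2 R (hits D a M L l' u x)) H.
by rewrite ltr_expR /=; lra.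
Qed.

Variable t' : R.
Hypotheses (t'0 : 0 < t') (t'1 : t' < 1) (dt : 1 <= t' * d%:R).

(** The family lists every visit below [(l, k)], with repetitions. Since [t' * d >= 1], the mean at
    [l'] is at most [t' ^ (l' - l)] times the mean at [l], which is below [4 * size V]; so the bound
    of [4 + 1/4] means becomes [17 * size V]. *)
Lemma spread_of_hits (M L l k : nat) (x : R) : (l <= L)%N -> adm D l k -> (0 < M)%N ->
  mean M L l / 4 < (hits D a M L l k x)%:R ->
  (forall l' u, (l' <= L)%N -> adm D l' u ->
    (hits D a M L l' u x)%:R < 4 * mean M L l' + 2 * (t' ^+ L * mean M L l / 8)) ->
  exists V : seq nat, [/\ (0 < size V)%N,
    forall m, m \in V -> [/\ adm D L m, anc (l, k) (L, m) &
      exists2 n, (M <= n < M + M)%N & residue (3 ^ L) ((a n)%:R * x) = m] &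
    forall l' u, (l <= l')%N -> (l' <= L)%N ->
        (count (fun m => m %/ 3 ^ (L - l') == u)%N V)%:R <= 17 * t' ^+ (l' - l) * (size V)%:R].
Proof.
move=> lL Dk M0 h1 h2.
pose r j := residue (3 ^ L) ((a j)%:R * x).
pose V := [seq r j | j <- index_iota M (M + M) & desc D L l k (r j)].
have d0 : (0 < d)%N by rewrite lt0n; apply/eqP => d0; move: dt; rewrite d0 mulr0 ler10.
have mean0 l' : 0 <= mean M L l' by rewrite divr_ge0 ?mulr_ge0.
have szV : size V = hits D a M L l k x by rewrite size_map size_filter.
exists V; split.
- by rewrite szV -(ltr_nat R) (le_lt_trans _ h1) // divr_ge0.
- move=> m /mapP[j]; rewrite mem_filter mem_index_iota => /andP[/andP[Dr rk] jM] ->.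
  by split => //; [rewrite /anc /= lL|exists j].
move=> l' u ll' l'L.
have cle : (count (fun m => m %/ 3 ^ (L - l') == u)%N V <= hits D a M L l' u x)%N.
  rewrite count_map count_filter; apply: sub_count => j /= /andP[H1 /andP[H2 _]].
  by rewrite /desc H2.
have [Du|nDu] := boolP (adm D l' u); last first.
  suff -> : count (fun m => m %/ 3 ^ (L - l') == u)%N V = 0%N.
    by rewrite !mulr_ge0 // exprn_ge0 // ltW.
  apply/eqP; move: cle; rewrite -leqn0 => /leq_trans; apply.
  rewrite leqn0 -[_ == _]negbK -lt0n -has_count; apply/hasP => -[j _ /andP[Dj /eqP ju]].
  by move: nDu; rewrite -ju; move: Dj; rewrite -{1}(subnKC l'L) => /adm_anc ->.
apply: (@le_trans _ _ (hits D a M L l' u x)%:R); first by rewrite ler_nat.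
apply: (le_trans (ltW (h2 _ _ l'L Du))); rewrite szV.
set h := (hits _ _ _ _ l _ _)%:R in h1 *.
have t0 e : 0 <= t' ^+ e by rewrite exprn_ge0 // ltW.
have m1 : mean M L l' <= t' ^+ (l' - l) * mean M L l.
  rewrite /mean (_ : (L - l = (l' - l) + (L - l'))%N); last by rewrite addnC addnBA // subnK.
  rewrite expnD natrM; set X := (d ^ (L - l'))%:R; set Y := (d ^ (l' - l))%:R.
  rewrite -[leLHS]mul1r (_ : t' ^+ (l' - l) * (M%:R * (Y * X) / (3 ^ L)%:R) =
    (t' ^+ (l' - l) * Y) * (M%:R * X / (3 ^ L)%:R)); last by ring.
  by apply: ler_wpM2r; rewrite ?divr_ge0 ?mulr_ge0 // /Y natrX -exprMn exprn_ege1.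
have m2 : t' ^+ L <= t' ^+ (l' - l).
  by apply: ler_wiXn2l; rewrite ?(ltW t'0) ?(ltW t'1) // (leq_trans (leq_subr _ _)).
have m3 : t' ^+ L * mean M L l <= t' ^+ (l' - l) * mean M L l by rewrite ler_wpM2r.
have m4 : t' ^+ (l' - l) * mean M L l <= t' ^+ (l' - l) * (4 * h).
  by rewrite ler_wpM2l //; lra.
lra.
Qed.
End spread.

(** * Spread families exist for almost every point *)

Section spread_ae.
Variables (R : realType) (D : pred nat) (a : nat -> nat) (t' b : R).
Let d := (D 0 + D 1 + D 2)%N.
Hypothesis apos : forall n, (1 <= n)%N -> (0 < a n)%N.
Hypothesis agrow : forall B, exists n0, forall n, (n0 <= n)%N -> (n ^ B * a n <= a n.+1)%N.
Hypotheses (t'0 : 0 < t') (t'1 : t' < 1) (dt : 1 <= t' * d%:R) (b1 : 1 < b) (bt : 1 < b * t' * d%:R / 3).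

(** Half of [b ^ L], so that all indices [n < M L + M L] of the block stay below [b ^ L]. *)
Let M L := Num.truncn (b ^+ L / 2).

Lemma near_block : \forall L \near \oo, b ^+ L / 4 <= (M L)%:R.
Proof.
near=> L.
have b4 : 4 <= b ^+ L by near: L; exact: near_expr_ge.
have : b ^+ L / 2 < (M L).+1%:R by exact: truncnS_gt.
by rewrite -[(M L).+1%:R]natr1; lra.
Unshelve. all: by end_near. Qed.

Lemma near_block_ge (N : nat) : \forall L \near \oo, (N <= M L)%N.
Proof.
near=> L.
have b4 : 4 * N%:R <= b ^+ L by near: L; exact: near_expr_ge.
have bM : b ^+ L / 4 <= (M L)%:R by near: L; exact: near_block.
by rewrite -(ler_nat R); apply: le_trans bM; rewrite ler_pdivlMr // mulrC.
Unshelve. all: by end_near. Qed.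

(** As [M L] grows exponentially in [L], a fixed [e] satisfies [3 ^ L <= M L ^ e] for large [L]; the
    required ratio is then at most [j ^ (e + 2)], which [agrow] supplies. *)
Lemma near_block_growth : \forall L \near \oo, forall j, (M L <= j)%N ->
  (M L + M L)%:R * (3 ^ L)%:R * (a j)%:R <= (a j.+1)%:R :> R.
Proof.
pose c := Num.sqrt b.
have c1 : 1 < c by rewrite -(@sqrtr1 R) ltr_sqrt // (lt_trans _ b1).
have c0 : 0 < c by rewrite (lt_trans _ c1).
have cc : c * c = b by rewrite -expr2 sqr_sqrtr // ltW // (lt_trans _ b1).
have [e ce] : exists e : nat, 3 <= c ^+ e := filter_ex (near_expr_ge 3 c1).
have [n0 n0P] := agrow (e + 2).
near=> L => j Mj.
have bM : b ^+ L / 4 <= (M L)%:R by near: L; exact: near_block.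
have c4 : 4 <= c ^+ L by near: L; exact: near_expr_ge.
have Mn : (maxn n0 2 <= M L)%N by near: L; exact: near_block_ge.
have M2 : (2 <= M L)%N by apply: leq_trans Mn; exact: leq_maxr.
have cM : c ^+ L <= (M L)%:R.
  by apply: le_trans bM; rewrite -cc exprMn ler_pdivlMr // ler_pM2l // exprn_gt0.
have M3 : (3 ^ L)%:R <= (M L)%:R ^+ e :> R.
  rewrite natrX; apply: (@le_trans _ _ ((c ^+ L) ^+ e)).
    by rewrite exprAC lerXn2r ?nnegrE ?exprn_ge0 ?(ltW c0).
  by rewrite lerXn2r ?nnegrE ?exprn_ge0 ?(ltW c0).
have M3' : ((M L + M L) * 3 ^ L <= M L ^ (e + 2))%N.
  rewrite expnD mulnC leq_mul //; first by rewrite -(ler_nat R) [leRHS]natrX.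
  by rewrite addnn -mul2n expnS expn1 leq_mul2r M2 orbT.
rewrite -!natrM ler_nat; apply: leq_trans (n0P j _).
  by rewrite leq_mul2r (leq_trans M3') ?orbT // leq_exp2r // addn2.
by rewrite (leq_trans _ Mj) // (leq_trans _ Mn) // leq_maxl.
Unshelve. all: by end_near. Qed.

Lemma near_block_start : \forall L \near \oo, (M L <= a (M L))%N.
Proof.
have [n0 n0P] := agrow 2.
near=> L.
have Mn : (maxn n0.+1 3 <= M L)%N by near: L; exact: near_block_ge.
have M3 : (3 <= M L)%N by apply: leq_trans Mn; exact: leq_maxr.
have Mn0 : (n0.+1 <= M L)%N by apply: leq_trans Mn; exact: leq_maxl.
case: (M L) M3 Mn0 => // m m2; rewrite ltnS => n0m.
apply: leq_trans (n0P m n0m).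
apply: (@leq_trans (m ^ 2)); last by rewrite leq_pmulr // apos // ltnW.
by rewrite -mulnn -[X in (X < _)%N]muln1 ltn_pmul2l // ltnW.
Unshelve. all: by end_near. Qed.

Let mean L l : R := (M L)%:R * (d ^ (L - l))%:R / (3 ^ L)%:R.

(** Up to a constant factor the right side is at least [(b * t' * d / 3) ^ L], whose base exceeds 1
    by [bt]. *)
Lemma near_mean_ge l : \forall L \near \oo, 4 * L%:R <= t' ^+ L * mean L l / 8.
Proof.
have d0 : (0 < d)%N by rewrite lt0n; apply/eqP => d0; move: dt; rewrite d0 mulr0 ler10.
have dl0 : 0 < (d ^ l)%:R :> R by rewrite ltr0n expn_gt0 d0.
pose c := 32 * (d ^ l)%:R : R.
near=> L.
have lL : (l <= L)%N by near: L; exact: nbhs_infty_ge.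
have bM : b ^+ L / 4 <= (M L)%:R by near: L; exact: near_block.
have cL : 4 * c * L%:R <= (b * t' * d%:R / 3) ^+ L by near: L; exact: near_expr_ge_linear.
have q0 : 0 < (3 ^ L)%:R :> R by rewrite ltr0n expn_gt0.
apply: (@le_trans _ _ ((b * t' * d%:R / 3) ^+ L / c)).
  by rewrite ler_pdivlMr ?mulr_gt0 //; apply: le_trans cL; rewrite mulrAC.
have -> : (b * t' * d%:R / 3) ^+ L / c = t' ^+ L * (b ^+ L / 4 * (d ^ (L - l))%:R / (3 ^ L)%:R) / 8.
  have dL : d%:R ^+ L = d%:R ^+ l * d%:R ^+ (L - l) :> R by rewrite -exprD subnKC.
  move: dl0 q0; rewrite /c !natrX !exprMn exprVn dL => dl0 q0.
  by field; rewrite !gt_eqF.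
rewrite ler_pM2r ?invr_gt0 // ler_wpM2l ?exprn_ge0 ?(ltW t'0) //.
by rewrite ler_pM2r ?invr_gt0 // ler_wpM2r.
Unshelve. all: by end_near. Qed.

(** The union bound runs over at most [6 ^ L] events, and by [near_mean_ge] each has measure at most
    a constant times [exp (- 4 * L) <= 16 ^- L]; a further factor [2 ^ L] absorbs the constant and
    [e]. *)
Lemma near_exception_small (A e : R) l : 0 < e -> 0 <= A ->
  \forall L \near \oo, (1 + L.+1%:R * (3 ^ L)%:R) * ((A + A) * expR (1 - t' ^+ L * mean L l / 8)) <= e.
Proof.
move=> e0 A0.
have L3 n : (0 < n)%N -> (n.+2 <= 3 * n)%N.
  by case: n => // n _; rewrite mulnS -addn3 addnC leq_add2l leq_pmull.
near=> L.
have mL : 4 * L%:R <= t' ^+ L * mean L l / 8 by near: L; exact: near_mean_ge.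
have L1 : (1 <= L)%N by near: L; exact: nbhs_infty_ge.
have L2 : 3 * L%:R <= 2 ^+ L :> R by near: L; apply: near_expr_ge_linear; rewrite ltr1n.
have Le : (A + A) * expR 1 / e <= 2 ^+ L by near: L; apply: near_expr_ge; rewrite ltr1n.
have H1 : 1 + L.+1%:R * (3 ^ L)%:R <= 2 ^+ L * 3 ^+ L :> R.
  have : 1 <= 3 ^+ L :> R by rewrite exprn_ege1 // ler1n.
  rewrite natrX; set x := 3 ^+ L => x1; apply: (@le_trans _ _ (L.+2%:R * x)).
    by rewrite -[L.+2%:R]natr1 mulrDl mul1r addrC lerD2l.
  have x0 : 0 <= x by apply: le_trans x1.
  rewrite ler_wpM2r //; apply: le_trans L2; rewrite -natrM ler_nat.
  exact: L3.
have H2 : expR (1 - t' ^+ L * mean L l / 8) <= expR 1 * (1 / 16) ^+ L.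
  apply: (@le_trans _ _ (expR (1 - 4 * L%:R))); first by rewrite ler_expR lerB.
  rewrite expRD ler_wpM2l ?expR_ge0 // mulrC -mulrN expRM_natl; apply: lerXn2r; rewrite ?nnegrE ?expR_ge0 ?divr_ge0 //.
  have -> : - 4 = (-1) * 4%:R :> R by rewrite mulN1r.
  rewrite mulrC expRM_natl; apply: (@le_trans _ _ ((1 / 2) ^+ 4)); last by rewrite expr_div_n expr1n; lra.
  apply: lerXn2r; rewrite ?nnegrE ?expR_ge0 ?divr_ge0 //.
  by rewrite expRN div1r lef_pV2 ?posrE ?expR_gt0 //; have := @expR_ge1Dx R 1; lra.
apply: (@le_trans _ _ (2 ^+ L * 3 ^+ L * ((A + A) * (expR 1 * (1 / 16) ^+ L)))).
  by apply: ler_pM => //; rewrite ?mulr_ge0 ?addr_ge0 ?expR_ge0 // ler_wpM2l // addr_ge0.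
have -> : 2 ^+ L * 3 ^+ L * ((A + A) * (expR 1 * (1 / 16) ^+ L)) =
    ((A + A) * expR 1) * (2 * 3 * (1 / 16)) ^+ L :> R by rewrite !exprMn; ring.
apply: (@le_trans _ _ ((2 ^+ L * e) * (2 * 3 * (1 / 16)) ^+ L)).
  by rewrite ler_wpM2r ?exprn_ge0 ?mulr_ge0 ?divr_ge0 // -ler_pdivrMr.
rewrite mulrAC -exprMn -[leRHS]mul1r ler_wpM2r ?(ltW e0) // exprn_ile1 //; lra.
Unshelve. all: by end_near. Qed.

Lemma spread_ae l k m0 : adm D l k -> {ae lebesgue_measure, forall x : R,
  exists (L : nat) (V : seq nat),
  [/\ (l + m0 <= L)%N, (0 < size V)%N,
      forall m, m \in V -> [/\ adm D L m, anc (l, k) (L, m) &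
        exists n, [/\ (m0 <= n)%N, (1 <= n)%N, n%:R < b ^+ L & residue (3 ^ L) ((a n)%:R * x) = m]] &
      forall l' u, (l <= l')%N -> (l' <= L)%N ->
        (count (fun m => m %/ 3 ^ (L - l') == u)%N V)%:R <= 17 * t' ^+ (l' - l) * (size V)%:R]}.
Proof.
move=> Dk; apply: ae_of_small_exceptions => A e e0.
(* The interval is empty for [A = 0]; for the others, radius at least 1 yields the length
   requirement of the moment bound from [M L <= a (M L)]. *)
case: A => [|A].
  by exists setT; split => //; rewrite oppr0 set_itvco0 set0I measure0 lee_fin ltW.
near \oo => L.
have lL : (l + m0 <= L)%N by near: L; exact: nbhs_infty_ge.
have lL' : (l <= L)%N by apply: leq_trans lL; exact: leq_addr.
have Mn : (maxn m0 1 <= M L)%N by near: L; exact: near_block_ge.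
have M0 : (0 < M L)%N by apply: leq_trans Mn; exact: leq_maxr.
have t1L : t' ^+ L <= 1 by rewrite exprn_ile1 // ltW.
have mean0 : 0 <= mean L l by rewrite divr_ge0 ?mulr_ge0.
have [B [mB muB nB]] : exists B : set R, [/\ measurable B,
    (lebesgue_measure (`[(- A.+1%:R)%R, A.+1%:R%R[ `&` B) <=
       ((1 + L.+1%:R * (3 ^ L)%:R) * ((A.+1%:R + A.+1%:R) * expR (1 - t' ^+ L * mean L l / 8)))%:E)%E &
    forall x, ~ B x -> mean L l / 4 < (hits D a (M L) L l k x)%:R /\
      forall l' u, (l' <= L)%N -> adm D l' u ->
       (hits D a (M L) L l' u x)%:R < 4 * mean L l' + 2 * (t' ^+ L * mean L l / 8)].
  apply: atypical_set => //.
  - by move=> j Mj; apply: apos; exact: leq_trans Mj.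
  - by near: L; exact: near_block_growth.
  - have : (M L <= a (M L))%N by near: L; exact: near_block_start.
    rewrite -(ler_nat R) !natrD => aM; have : 1 <= A.+1%:R :> R by rewrite ler1n.
    have a0 : 0 <= (a (M L))%:R :> R by [].
    move: a0 aM; move: (M L)%:R (a (M L))%:R A.+1%:R => x y z y0 xy z1.
    apply: (@le_trans _ _ ((1 + 1) * y)); first by lra.
    by rewrite ler_wpM2r //; lra.
  - have : t' ^+ L * mean L l <= mean L l by rewrite -[leRHS]mul1r ler_wpM2r.
    rewrite -/(mean L l); lra.
exists B; split => //; last first.
  apply: (le_trans muB); rewrite lee_fin.
  by near: L; apply: near_exception_small.
move=> x _ nP; apply: contrapT => nBx; apply: nP.
have [h1 h2] := nB _ nBx.
have [V [V0 VP Vc]] := spread_of_hits t'0 t'1 dt lL' Dk M0 h1 h2.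
exists L, V; split => // m /VP[Dm vm [n /andP[Mn1 nM] rn]]; split => //; exists n; split => //.
- by rewrite (leq_trans _ Mn1) // (leq_trans _ Mn) // leq_maxl.
- exact: leq_trans Mn1.
have : (M L)%:R <= b ^+ L / 2 by rewrite truncn_le divr_ge0 // exprn_ge0 // ltW // (lt_trans _ b1).
by move: nM; rewrite -(ltr_nat R) natrD; lra.
Unshelve. all: by end_near. Qed.
End spread_ae.

(** * Hausdorff measure: lower bounds *)

Lemma powR_gt1 (R : realType) (a s : R) : 1 < a -> 0 < s -> 1 < a `^ s.
Proof.
move=> a1 s0; rewrite /powR gt_eqF ?(lt_trans _ a1) // -expR0 ltr_expR.
by rewrite mulr_gt0 // ln_gt0.
Qed.

Lemma diam_ub (R : realType) (A : set R) x y : A x -> A y -> (`|x - y|%:E <= diam A)%E.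
Proof. by move=> Ax Ay; apply: ereal_sup_ubound; exists x => //; exists y. Qed.

Lemma diam_le (R : realType) (A : set R) (r : R) :
  (forall x y, A x -> A y -> `|x - y| <= r) -> (diam A <= r%:E)%E.
Proof. by move=> H; apply: ge_ereal_sup => _ [x Ax [y Ay <-]]; rewrite lee_fin H. Qed.

Lemma diam_fin (R : realType) (A : set R) (r : R) : A !=set0 -> (diam A <= r%:E)%E ->
  exists2 q, diam A = q%:E & 0 <= q <= r.
Proof.
move=> [x Ax]; have := diam_ub Ax Ax; rewrite subrr normr0.
by case: (diam A) => [q||] //; rewrite !lee_fin => q0 qr; exists q; rewrite ?q0.
Qed.

Lemma diam_pow_ge0 (R : realType) (s : R) (A : set R) : (0 <= diam_pow s A)%E.
Proof. by rewrite /diam_pow; case: ifP => // _; exact: poweR_ge0. Qed.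

Lemma diam_pow_le (R : realType) (s r : R) (A : set R) : 0 <= s -> 0 <= r ->
  (forall x y, A x -> A y -> `|x - y| <= r) -> (diam_pow s A <= (r `^ s)%:E)%E.
Proof.
move=> s0 r0 Ar; rewrite /diam_pow; case: asboolP => [_|/eqP/set0P A0].
  by rewrite lee_fin powR_ge0.
have [q -> /andP[q0 qr]] := diam_fin A0 (diam_le Ar).
by rewrite poweR_EFin lee_fin ge0_ler_powR.
Qed.

Lemma pow3N (R : realType) (s : R) n : (3 `^ (- s)) ^+ n = (3 ^- n) `^ s :> R.
Proof.
rewrite -powR_mulrn ?powR_ge0 // -powRrM.
have -> : 3 ^- n = 3 `^ (- n%:R) :> R by rewrite powRN powR_mulrn.
by rewrite -powRrM; congr (_ `^ _); ring.
Qed.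

(** A set of a cover is traded for the triadic level just above its diameter [r]; since [r <= 1],
    [r ^ s1 <= r ^ s]. Empty sets and sets of diameter 0 have no such level, and the allowance [e]
    pays for a deep level instead. *)
Lemma triadic_scale (R : realType) (A : set R) (s s1 e : R) : 0 <= s -> s <= s1 -> 0 < s1 -> 0 < e ->
  (diam A <= 1%:E)%E -> exists l : nat,
  (forall x y, A x -> A y -> `|x - y| <= 3 ^- l) /\
  (((3 `^ (- s1)) ^+ l)%:E <= (3 `^ s1)%:E * diam_pow s A + e%:E)%E.
Proof.
move=> s0 ss1 s10 e0 A1.
have [l le] : exists l, (3 `^ (- s1)) ^+ l <= e.
  have : (fun n => (3 `^ (- s1)) ^+ n) @ \oo --> (0 : R).
    by apply: cvg_expr; rewrite ger0_norm ?powR_ge0 // powRN invf_lt1 ?powR_gt0 // powR_gt1 ?ltr1n.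
  move=> /cvgr0_norm_le /(_ _ e0)[n _ /(_ n (leqnn n))] H; exists n.
  by apply: le_trans H; exact: ler_norm.
have small : (forall x y, A x -> A y -> `|x - y| <= 0) -> exists l : nat,
  (forall x y, A x -> A y -> `|x - y| <= 3 ^- l) /\
  (((3 `^ (- s1)) ^+ l)%:E <= (3 `^ s1)%:E * diam_pow s A + e%:E)%E.
  move=> H; exists l; split.
    by move=> x y Ax Ay; apply: (le_trans (H x y Ax Ay)); rewrite invr_ge0 exprn_ge0.
  rewrite -[leLHS]add0e; apply: leeD; last by rewrite lee_fin.
  by rewrite mule_ge0 ?lee_fin ?powR_ge0 // diam_pow_ge0.
have [AE|/set0P A0] := eqVneq A set0; first by apply: small => x y; rewrite AE.
have [r Ar /andP[r0 r1]] := diam_fin A0 A1.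
have Ale x y : A x -> A y -> `|x - y| <= r.
  by move=> Ax Ay; rewrite -lee_fin -Ar diam_ub.
have [r00|rneq0] := eqVneq r 0; first by apply: small; rewrite -r00.
have rgt0 : 0 < r by rewrite lt_neqAle eq_sym rneq0.
have exn : exists n, 3 ^- n < r.
  have : (fun n => 3^-1 ^+ n) @ \oo --> (0 : R).
    by apply: cvg_expr; rewrite ger0_norm ?invr_ge0 // invf_lt1 // ltr1n.
  have r20 : 0 < r / 2 by rewrite divr_gt0.
  move=> /cvgr0_norm_le /(_ _ r20)[n _ /(_ n (leqnn n))] H; exists n.
  rewrite -exprVn; apply: (@le_lt_trans _ _ (r / 2)); last by rewrite ltr_pdivrMr // ltr_pMr // ltr1n.
  by apply: le_trans H; exact: ler_norm.
case: (ex_minnP exn) => -[|n] nr nmin; first by move: nr; rewrite expr0 invr1 ltNge r1.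
have rn : r <= 3 ^- n by rewrite leNgt; apply/negP => /nmin; rewrite ltnn.
exists n; split; first by move=> x y Ax Ay; apply: le_trans rn; exact: Ale.
have -> : diam_pow s A = (r `^ s)%:E.
  by rewrite /diam_pow asboolF ?Ar ?poweR_EFin //; apply/eqP/set0P.
rewrite -EFinM -EFinD lee_fin.
have -> : (3 `^ (- s1)) ^+ n = 3 `^ s1 * (3 `^ (- s1)) ^+ n.+1 :> R.
  by rewrite exprS mulrA powRN mulfV ?mul1r // gt_eqF // powR_gt0.
apply: (@le_trans _ _ (3 `^ s1 * r `^ s)); last by rewrite lerDl ltW.
rewrite ler_wpM2l ?powR_ge0 // pow3N; apply: (@le_trans _ _ (r `^ s1)).
  by apply: ge0_ler_powR; rewrite ?nnegrE ?invr_ge0 ?exprn_ge0 ?(ltW s10) // ltW.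
by apply: ger_powR => //; rewrite rgt0.
Qed.

(** Cells are closed, so that nested cells have a common point and limits of points of a cell stay
    in it. *)
Definition in_cell {R : realType} (v : nat * nat) (y : R) : bool :=
  v.2%:R <= 3 ^+ v.1 * y <= v.2%:R + 1.

Lemma in_cell_anc (R : realType) v w (y : R) : anc v w -> in_cell w y -> in_cell v y.
Proof.
move: v w => [l k] [L m] /andP[/= lL /eqP <-] /andP[/= H1 H2]; rewrite /in_cell /=.
set e := (L - l)%N; have e0 : 0 < 3 ^+ e :> R by rewrite exprn_gt0.
have E : 3 ^+ L * y = 3 ^+ e * (3 ^+ l * y) by rewrite mulrA -exprD subnK.
have eE : 3 ^+ e = (3 ^ e)%:R :> R by rewrite natrX.
apply/andP; split; rewrite -(ler_pM2l e0) -E eE.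
  by rewrite -natrM; apply: le_trans H1; rewrite ler_nat mulnC leq_trunc_div.
by rewrite natr1 -natrM; apply: (le_trans H2); rewrite natr1 ler_nat mulnC ltn_ceil // expn_gt0.
Qed.

Lemma anc_path (x : nat -> nat * nat) : (forall j, anc (x j) (x j.+1)) ->
  forall i j, (i <= j)%N -> anc (x i) (x j).
Proof.
move=> xx i j /subnKC <-; elim: (j - i)%N => [|n IH]; first by rewrite addn0 anc_refl.
by rewrite addnS; apply: anc_trans (xx _).
Qed.

Lemma nested_cells (R : realType) (x : nat -> nat * nat) : (forall j, anc (x j) (x j.+1)) ->
  exists y : R, forall j, in_cell (x j) y.
Proof.
move=> /anc_path xx.
pose u j : R := (x j).2%:R / 3 ^+ (x j).1.
have p0 l : 0 < 3 ^+ l :> R by rewrite exprn_gt0.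
have uu j : in_cell (x j) (u j).
  by rewrite /in_cell /u mulrC divfK ?gt_eqF // lexx lerDl /=.
have uc i j : (i <= j)%N -> in_cell (x i) (u j) by move=> /xx /in_cell_anc; apply.
have uv i j : u i <= ((x j).2%:R + 1) / 3 ^+ (x j).1.
  have [ij|/ltnW ji] := leqP i j; last first.
    by rewrite ler_pdivlMr // mulrC; case/andP: (uc _ _ ji).
  apply: (@le_trans _ _ (u j)).
    by rewrite {1}/u ler_pdivrMr // mulrC; case/andP: (uc _ _ ij).
  by rewrite /u ler_pM2r ?invr_gt0 // lerDl.
have us : has_sup (range u).
  by split; [exists (u 0%N), 0%N|exists (((x 0%N).2%:R + 1) / 3 ^+ (x 0%N).1) => _ [i _ <-]; exact: uv].
exists (sup (range u)) => j; apply/andP; split.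
  rewrite mulrC -ler_pdivrMr //; apply: ub_le_sup; first by case: us.
  by exists j.
rewrite mulrC -ler_pdivlMr //; apply: ge_sup; first by case: us.
by move=> _ [i _ <-]; exact: uv.
Qed.

Section lower.
Variables (R : realType) (D : pred nat) (s s' C : R) (G : nat -> nat -> nat -> Prop) (E : set R).
Hypotheses (s0 : 0 <= s) (ss' : s < s') (C1 : 1 <= C).
Hypothesis Gmono : forall m n L k, (m <= n)%N -> G n L k -> G m L k.
Hypothesis spread : forall l k m0, adm D l k -> exists (L : nat) (V : seq nat),
  [/\ (l + m0 <= L)%N, (0 < size V)%N,
      forall m, m \in V -> [/\ adm D L m, anc (l, k) (L, m) & G m0 L m] &
      forall l' u, (l <= l')%N -> (l' <= L)%N ->
        (count (fun m => m %/ 3 ^ (L - l') == u)%N V)%:R <= C * (3 `^ (- s')) ^+ (l' - l) * (size V)%:R].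
Hypothesis Epath : forall (x : nat -> nat * nat) (y : R),
  (forall j, [/\ adm D (x j).1 (x j).2, anc (x j) (x j.+1), ((x j).1 < (x j.+1).1)%N &
      G j (x j.+1).1 (x j.+1).2]) -> (forall j, in_cell (x j) y) -> E y.

(** If the measure were 0, some cover would have a tiny [s]-sum. Each of its sets is handled by four
    cells of comparable size, the words of these cells form a sparse family, and a path avoiding
    them ends at a point of [E] outside the cover. *)
Lemma hausdorff_measure_neq0 : hausdorff_measure s E <> 0%E.
Proof.
move=> Es0.
(* An exponent strictly between leaves room for [tree_avoid], and is positive even when [s = 0]. *)
pose s1 := (s + s') / 2; have [ss1 s1s'] : s < s1 /\ s1 < s' by have := ss'; rewrite /s1; split; lra.
have s10 : 0 < s1 by apply: le_lt_trans ss1.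
pose t := 3 `^ (- s1) : R.
have t0 : 0 < t by rewrite powR_gt0.
have tt : 3 `^ (- s') < t.
  rewrite /t (_ : - s1 = - s' + (s' - s1)); last by ring.
  rewrite powRD; last by rewrite pnatr_eq0 implybT.
  by rewrite ltr_pMr ?powR_gt0 // powR_gt1 ?ltr1n // subr_gt0.
have [c c0 cP] := tree_avoid (powR_gt0 _ (ltr0n _ 3)) tt C1 Gmono spread.
pose T := 3 `^ s1 : R; have T0 : 0 < T by rewrite powR_gt0.
(* With four words per set, the weights sum to at most [4 * (T * eta + eta)], hence to at most
   [c]. *)
pose eta := c / (4 * (T + 2)); have eta0 : 0 < eta by rewrite divr_gt0 // mulr_gt0 // addr_gt0.
have [U [Ucov U1] Ueta] : exists2 U : nat -> set R,
    E `<=` \bigcup_i U i /\ (forall i, (diam (U i) <= 1%:E)%E) &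
    (\sum_(0 <= i <oo) diam_pow s (U i) < eta%:E)%E.
  have : (hausdorff_content s 1 E < eta%:E)%E.
    apply: (@le_lt_trans _ _ 0%E); last by rewrite lte_fin.
    by rewrite -[leRHS]Es0; apply: ereal_sup_ubound; exists 1; rewrite /= ?ltr01.
  by move=> /ereal_inf_lt[_ [U [H1 H2] <-] H3]; exists U.
have e0 i : 0 < eta / (2 ^ i.+1)%:R by rewrite divr_gt0 // ltr0n expn_gt0.
have [l lP] := choice (fun i => triadic_scale s0 (ltW ss1) s10 (e0 i) (U1 i)).
have pE i : exists y : R, U i !=set0 -> U i y.
  by have [[y Uy]|nU] := pselect (U i !=set0); [exists y|exists 0].
have [p pP] := choice pE.
(* Indices [4 * i] to [4 * i + 3] list four consecutive cells of level [l i], starting two before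
   that of [p i], or at 0 when the subtraction truncates. *)
pose w m := (l (m %/ 4)%N, (Num.truncn (3 ^+ l (m %/ 4) * p (m %/ 4)) - 2 + m %% 4)%N).
have wc : (\sum_(i <oo) (t ^+ (w i).1)%:E <= c%:E)%E.
  have S1 : (\sum_(0 <= i <oo) (T%:E * diam_pow s (U i) + (eta / (2 ^ i.+1)%:R)%:E) <= (c / 4)%:E)%E.
    apply: (@le_trans _ _ (T%:E * eta%:E + eta%:E)%E); last first.
      rewrite -EFinM -EFinD lee_fin.
      have -> : c / 4 = (T + 2) * eta by rewrite /eta; field; rewrite gt_eqF // addr_gt0.
      by rewrite mulrDl lerD2l ler_peMl ?(ltW eta0) // ler1n.
    have := @epsilon_trick R (fun i => T%:E * diam_pow s (U i))%E eta xpredT.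
    move=> /(_ _ (ltW eta0)) /le_trans; apply.
      by move=> i; rewrite mule_ge0 ?diam_pow_ge0 // lee_fin ltW.
    rewrite leeD2r // nneseriesZl; last by move=> i _; exact: diam_pow_ge0.
    by rewrite lee_wpmul2l ?lee_fin ?ltW.
  apply: lime_le; first by apply: is_cvg_nneseries => i _ _; rewrite lee_fin exprn_ge0 // ltW.
  near=> n.
  apply: (@le_trans _ _ (\sum_(0 <= i < n * 4) (t ^+ (w i).1)%:E)%E).
    rewrite [leRHS](big_cat_nat (n := n)) ?leq_pmulr //= leeDl // sume_ge0 // => i _.
    by rewrite lee_fin exprn_ge0 // ltW.
  rewrite big_nat_mul_block /=.
  apply: (@le_trans _ _ (4%:E * \sum_(0 <= i < n) (t ^+ l i)%:E)%E).
    under eq_bigr do rewrite sumEFin.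
    rewrite !sumEFin -EFinM lee_fin mulr_sumr; apply: ler_sum_nat => i _.
    rewrite (eq_big_nat _ _ (F2 := fun=> t ^+ l i)); last first.
      by move=> r /andP[_ r4]; rewrite divnMDl // divn_small // addn0.
    by rewrite sumr_const_nat subn0 mulr_natl.
  have -> : c%:E = (4%:E * (c / 4)%:E)%E by rewrite -EFinM mulrC divfK.
  rewrite lee_wpmul2l ?lee_fin //; apply: le_trans S1.
  apply: le_trans (nneseries_lim_ge n _).
    by apply: lee_sum => i _; case: (lP i).
  move=> i _ _; rewrite adde_ge0 ?mule_ge0 ?diam_pow_ge0 ?lee_fin //; exact: ltW.
have [x xP] := cP w wc.
have [y yP] : exists y : R, forall j, in_cell (x j) y.
  by apply: nested_cells => j; have [] := xP j.
have [i _ Uy] : (\bigcup_i U i) y.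
  by apply: Ucov; apply: (Epath (x := x)) => // j; have [] := xP j.
have Up : U i (p i) by apply: pP; exists y.
have jx j : (j <= (x j).1)%N.
  by elim: j => // j IH; apply: leq_ltn_trans IH _; have [] := xP j.
have [Ul _] := lP i; have := Ul _ _ Up Uy.
case: (x (l i)) (jx (l i)) (yP (l i)) (xP (l i)) => L m /= lL yLm [_ _ _ _ /=].
pose k := (m %/ 3 ^ (L - l i))%N.
have ak : anc (l i, k) (L, m) by rewrite /anc /= lL eqxx.
have /andP[/= ky1 ky2] := in_cell_anc ak yLm.
set q := 3 ^+ l i * p i.
move=> nw py.
have q3 : 0 < 3 ^+ l i :> R by rewrite exprn_gt0.
(* As [y] is within one cell length of [p i], the code [k] of its cell lies between [truncn q - 2]
   and [truncn q + 1], so it is one of the four listed. *)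
have : `|q - 3 ^+ l i * y| <= 1.
  by rewrite /q -mulrBr normrM gtr0_norm // -ler_pdivlMl // mulr1.
rewrite ler_norml => /andP[qy1 qy2].
have kT1 : (k < (Num.truncn q).+2)%N.
  rewrite -(ltr_nat R); have := truncnS_gt q.
  rewrite -[(Num.truncn q).+2%:R]natr1; lra.
have kT2 : ((Num.truncn q) <= k + 2)%N.
  have [q0|q0] := leP 0 q; last by rewrite truncn_floor leNgt q0.
  rewrite -(ler_nat R) natrD; have : (Num.truncn q)%:R <= q by rewrite truncn_le.
  lra.
pose b := (Num.truncn q - 2)%N.
have bk : (b <= k)%N by rewrite leq_subLR addnC.
have kb : (k - b < 4)%N.
  suff H n z : (n < z.+2)%N -> (n - (z - 2) < 4)%N by exact: H.
  by clear; lia.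
have := nw (i * 4 + (k - b))%N.
rewrite /w divnMDl // divn_small // addn0 modnMDl modn_small // -/q -/b subnKC //.
by rewrite ak.
Unshelve. all: by end_near. Qed.
End lower.

(** * Hausdorff measure of limsup sets *)

Lemma dist_int_lt (R : realType) (x e : R) : dist_int x < e <-> exists k : int, `|x - k%:~R| < e.
Proof.
rewrite /dist_int gt_min; split.
  have /andP[f1 _] := floor_itv x; have /andP[_ c2] := ceil_itv x.
  move=> /orP[H|H].
    by exists (Num.floor x); rewrite ger0_norm // subr_ge0.
  by exists (Num.ceil x); rewrite distrC ger0_norm // subr_ge0.
move=> [k xk]; have [kx|xk'] := lerP k%:~R x.
  apply/orP; left; apply: le_lt_trans xk; rewrite ger0_norm ?subr_ge0 //.
  by rewrite lerB // ler_int floor_ge_int.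
apply/orP; right; apply: le_lt_trans xk; rewrite distrC ger0_norm ?subr_ge0 ?(ltW xk') //.
by rewrite lerB // ler_int ceil_le_int ltW.
Qed.

Lemma hausdorff_content_ge0 (R : realType) (s d : R) (E : set R) : (0 <= hausdorff_content s d E)%E.
Proof.
by apply: le_ereal_inf_tmp => _ [U _ <-]; apply: nneseries_ge0 => i _ _; exact: diam_pow_ge0.
Qed.

Lemma hausdorff_measure_eq0 (R : realType) (s : R) (E : set R) :
  (forall d e : R, 0 < d -> 0 < e -> (hausdorff_content s d E <= e%:E)%E) ->
  hausdorff_measure s E = 0%E.
Proof.
move=> H; apply/eqP; rewrite eq_le; apply/andP; split.
  apply: ge_ereal_sup => _ [d d0 <-]; apply/lee_addgt0Pr => e e0; rewrite add0e.
  exact: H.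
apply: le_trans (hausdorff_content_ge0 s 1 E) _.
by apply: ereal_sup_ubound; exists 1; rewrite /= ?ltr01.
Qed.

Lemma hausdorff_content_bigcup2 (R : realType) (s d : R) (E : set R) (V : nat -> nat -> set R) (c : R) :
  E `<=` \bigcup_j \bigcup_n V j n -> (forall j n, (diam (V j n) <= d%:E)%E) ->
  (forall j, (\sum_(n <oo) diam_pow s (V j n) <= (c / (2 ^ j.+1)%:R)%:E)%E) -> 0 <= c ->
  (hausdorff_content s d E <= c%:E)%E.
Proof.
move=> EV dV sV c0.
pose W (p : nat * nat) := V p.1 p.2.
have W0 p : (0 <= diam_pow s (W p))%E by exact: diam_pow_ge0.
have /card_esym/ppcard_eqP[f] := card_nat2.
apply: (@le_trans _ _ (\sum_(i <oo) diam_pow s (W (f i)))%E).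
  apply: ereal_inf_lbound; exists (W \o f) => //; split => [t|i]; last exact: dV.
  move=> /EV[j _ [n _ Vt]]; exists (f^-1%FUN (j, n)) => //=.
  by rewrite /W invK ?inE.
rewrite nneseries_esum // (_ : [set x | xpredT x] = setT); last by apply/seteqP.
rewrite -(@reindex_esum R nat (nat * nat)%type setT setT f (fun p => diam_pow s (W p))); last exact: bij.
have -> : [set: nat * nat] = [set: nat] `*`` (fun=> [set: nat]) by apply/seteqP.
rewrite -(@esum_esum R nat nat setT (fun=> setT) (fun i j => diam_pow s (W (i, j)))) //.
rewrite (_ : setT = [set x | xpredT x]); last by apply/seteqP.
rewrite -nneseries_esum; last by move=> j _; apply: esum_ge0.
have := @epsilon_trick R (fun=> 0)%E c xpredT (fun=> lexx _) c0.
rewrite (eseries0 (f := fun=> 0%E)) // add0e; apply: le_trans.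
apply: lee_nneseries => [j _ _|j _]; first exact: esum_ge0.
by rewrite add0e; have := sV j; rewrite nneseries_esum // => n _; exact: diam_pow_ge0.
Qed.

(* A point at distance less than 1 from [c n + Z] is near one of three translates, so the
   tail for the translate number [j] may start at its own index [N j]. *)
Lemma hausdorff_measure_limsup (R : realType) (c r : nat -> R) (P : pred nat) (s : R) (E : set R) :
  0 < s -> (forall n, 0 <= r n) -> r @ \oo --> 0 ->
  (\sum_(n <oo) (if P n then r n `^ s else 0)%:E < +oo)%E ->
  (forall xi, E xi -> forall N, exists n, [/\ (N <= n)%N, P n & dist_int (c n - xi) < r n]) ->
  hausdorff_measure s E = 0%E.
Proof.
move=> s0 r0 rto0 sumr HE; apply: hausdorff_measure_eq0 => d e d0 e0.
pose f n := if P n then r n `^ s else 0.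
have f0 n : 0 <= f n by rewrite /f; case: ifP => // _; exact: powR_ge0.
pose T := 2 `^ s : R; have T0 : 0 < T by rewrite powR_gt0.
have [N0 N0P] : exists N0, forall n, (N0 <= n)%N -> r n <= Num.min (d / 2) 1.
  have m0 : 0 < Num.min (d / 2) 1 by rewrite lt_min divr_gt0 ?ltr01.
  move/cvgr0_norm_le: rto0 => /(_ _ m0)[N _ NP]; exists N => n Nn.
  exact: le_trans (ler_norm _) (NP n Nn).
(* The factor [T = 2 ^ s] accounts for diameters [2 * r n], the factor [2 ^ j.+1] for the sum over
   all translates. *)
have tail j : exists N, (N0 <= N)%N /\ (\sum_(N <= n <oo) (f n)%:E <= (e / (2 ^ j.+1)%:R / T)%:E)%E.
  have e1 : 0 < e / (2 ^ j.+1)%:R / T by rewrite !divr_gt0 // ltr0n expn_gt0.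
  have := nneseries_tail_cvg sumr (fun n _ => f0 n).
  move=> /(_ _ (nbhs_open_ereal_lt (f := cst (e / (2 ^ j.+1)%:R / T)) e1))[N _ NP].
  by exists (maxn N0 N); rewrite leq_maxl; split => //; apply: ltW; apply: NP; exact: leq_maxr.
have [N NP] := choice tail.
pose k j : int := odflt 0 (unpickle j).
pose y n := c n - (Num.floor (c n))%:~R.
pose V j n := if (N j <= n)%N && P n then [set xi : R | `|y n + (k j)%:~R - xi| < r n] else set0.
have Vdiam j n xi xi' : V j n xi -> V j n xi' -> [/\ (N j <= n)%N, P n & `|xi - xi'| <= 2 * r n].
  rewrite /V; case: ifP => // /andP[jn Pn] /= h1 h2; split => //.
  rewrite (_ : xi - xi' = (y n + (k j)%:~R - xi') - (y n + (k j)%:~R - xi)); last by ring.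
  by apply: (le_trans (ler_normB _ _)); move: (ltW h1) (ltW h2); lra.
apply: (@hausdorff_content_bigcup2 _ _ _ _ V); last exact: ltW.
- move=> xi /HE xiE; have /andP[z1 z2] := floor_itv xi.
  set z := Num.floor xi in z1 z2.
  pose M := maxn (N (pickle (z - 1))) (maxn (N (pickle z)) (N (pickle (z + 1)))).
  have [n [Mn Pn]] := xiE (maxn N0 M).
  move=> /dist_int_lt[m mxi].
  have [N0n Mn'] : (N0 <= n)%N /\ (M <= n)%N by move: Mn; rewrite geq_max => /andP[].
  have rn1 : r n <= 1 by have := N0P n N0n; rewrite le_min => /andP[].
  have /andP[y1 y2] := floor_itv (c n).
  pose q : int := Num.floor (c n) - m.
  have qE : y n + q%:~R - xi = c n - xi - m%:~R by rewrite /y /q intrB; ring.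
  have qM : (N (pickle q) <= n)%N.
    have H x : (x <= M)%N -> (x <= n)%N by move=> xM; apply: leq_trans Mn'.
    have /orP[/eqP ->|/orP[/eqP ->|/eqP ->]] : [|| q == z - 1, q == z | q == z + 1].
    - have : `|y n + q%:~R - xi| < 1 by rewrite qE; apply: lt_le_trans rn1.
      rewrite ltr_norml => /andP[q1 q2].
      have q3 : z - 2 < q.
        by rewrite -(ltr_int R) intrB; move: q1 q2 y1 y2 z1 z2; rewrite /y !intrD; lra.
      have q4 : q < z + 2.
        by rewrite -(ltr_int R) intrD; move: q1 q2 y1 y2 z1 z2; rewrite /y !intrD; lra.
      by move: q3 q4; clear; lia.
    - by apply: H; rewrite /M leq_maxl.
    - by apply: H; rewrite /M !leq_max leqnn ?orbT.
    - by apply: H; rewrite /M !leq_max leqnn ?orbT.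
  exists (pickle q) => //; exists n => //.
  by rewrite /V qM Pn /= /k pickleK /= qE.
- move=> j n; apply: diam_le => xi xi' h1 h2; have [jn _ H] := Vdiam _ _ _ _ h1 h2.
  apply: (le_trans H); have := N0P n (leq_trans (NP j).1 jn).
  by rewrite le_min => /andP[+ _]; lra.
move=> j.
apply: (@le_trans _ _ (\sum_(n <oo) (if (N j <= n)%N then T%:E * (f n)%:E else 0))%E).
  apply: lee_nneseries => [n _ _|n _]; first exact: diam_pow_ge0.
  case: ifP => jn; last first.
    by rewrite /diam_pow /V jn /=; case: asboolP.
  have r2 : 0 <= 2 * r n by rewrite mulr_ge0.
  rewrite -EFinM /f; case: ifP => Pn; last by rewrite /diam_pow /V jn Pn /= mulr0; case: asboolP.
  rewrite /T -powRM //; apply: diam_pow_le => //; first exact: ltW.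
  by move=> xi xi' h1 h2; have [] := Vdiam _ _ _ _ h1 h2.
rewrite -eseries_mkcond.
have -> : (\sum_(n <oo | (N j <= n)%N) (T%:E * (f n)%:E) = \sum_(N j <= n <oo) (T%:E * (f n)%:E))%E.
  by rewrite [RHS]eseries_cond.
rewrite nneseriesZl; last by move=> n _; rewrite lee_fin.
apply: (@le_trans _ _ (T%:E * (e / (2 ^ j.+1)%:R / T)%:E)%E).
  by rewrite lee_wpmul2l ?lee_fin ?(ltW T0) //; case: (NP j).
by rewrite -EFinM lee_fin mulrC divfK // gt_eqF.
Qed.

(** * The Cantor set *)

Lemma powR_nat_ge1 (R : realType) (n : nat) (p : R) : (0 < n)%N -> 0 <= p -> 1 <= n%:R `^ p.
Proof. by move=> n0 p0; rewrite -[leLHS](powRr0 n%:R) ler_powR // ler1n. Qed.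

(** Dyadic condensation: the block from [2 ^ m] to [2 ^ m.+1] contributes at most [q ^ m] with
    [q = 2 ^ (1 - p) < 1]. The term [n = 0] vanishes, as powers of 0 with nonzero exponent are 0. *)
Lemma p_series (R : realType) (p : R) : 1 < p -> (\sum_(n <oo) (n%:R `^ (- p))%:E < +oo)%E.
Proof.
move=> p1; have p0 : 0 < p by lra.
pose u n : R := n%:R `^ (- p).
have u0 n : 0 <= u n by exact: powR_ge0.
have um m n : (0 < m)%N -> (m <= n)%N -> u n <= u m.
  move=> m0 mn; rewrite /u !powRN lef_pV2 ?posrE ?powR_gt0 ?ltr0n ?(leq_trans m0) //.
  by rewrite ge0_ler_powR ?nnegrE ?ler_nat // ltW.
pose q : R := 2 `^ (1 - p).
have q0 : 0 < q by exact: powR_gt0.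
have q1 : q < 1.
  by rewrite /q -opprB powRN invf_lt1 ?powR_gt0 // powR_gt1 ?ltr1n // subr_gt0.
have block m : \sum_(2 ^ m <= n < 2 ^ m.+1) u n <= q ^+ m.
  apply: (@le_trans _ _ (\sum_(2 ^ m <= n < 2 ^ m.+1) u (2 ^ m)%N)).
    by apply: ler_sum_nat => n /andP[mn _]; apply: um => //; rewrite expn_gt0.
  rewrite sumr_const_nat expnS mul2n -addnn addnK -mulr_natl /u natrX.
  rewrite -powR_mulrn // -powRrM -powRD; last by rewrite pnatr_eq0 implybT.
  rewrite -powR_mulrn ?(ltW q0) // /q -powRrM le_eqVlt; apply/orP; left; apply/eqP.
  by congr (_ `^ _); ring.
have psum m : \sum_(0 <= n < 2 ^ m) u n <= (1 - q ^+ m) / (1 - q).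
  elim: m => [|m IH].
    by rewrite expn0 big_nat1 /u powR0 ?oppr_eq0 ?gt_eqF // expr0 subrr mul0r.
  rewrite (big_cat_nat (n := (2 ^ m)%N)) //=; last by rewrite leq_pexp2l.
  apply: (le_trans (lerD IH (block m))).
  rewrite -[X in _ + X](mulfK (_ : 1 - q != 0)) ?gt_eqF ?subr_gt0 // -mulrDl.
  rewrite ler_pM2r ?invr_gt0 ?subr_gt0 // exprS; lra.
apply: (@le_lt_trans _ _ ((1 - q)^-1)%:E); last exact: ltry.
apply: lime_le; first by apply: is_cvg_nneseries => n _ _; rewrite lee_fin.
near=> m; rewrite sumEFin lee_fin.
apply: (@le_trans _ _ (\sum_(0 <= n < 2 ^ m) u n)).
  rewrite [leRHS](big_cat_nat (n := m)) //=; last by rewrite ltnW // ltn_expl.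
  by rewrite lerDl sumr_ge0.
apply: (le_trans (psum m)); rewrite ler_pdivrMr ?subr_gt0 // mulVf ?gt_eqF ?subr_gt0 //.
by rewrite lerBlDr lerDl exprn_ge0 // ltW.
Unshelve. all: by end_near. Qed.

Lemma kappa_pow (R : realType) : 3 `^ kappa = 2 :> R.
Proof.
rewrite /powR gt_eqF // /kappa divfK ?lnK ?posrE //.
by rewrite gt_eqF // ln_gt0 // ltr1n.
Qed.

Lemma kappa_lt1 (R : realType) : kappa < 1 :> R.
Proof.
rewrite /kappa ltr_pdivrMr ?ln_gt0 ?ltr1n // mul1r ltr_ln ?posrE //.
by rewrite ltr_nat.
Qed.

Definition cantor_digit : pred nat := fun i => (i == 0%N) || (i == 2%N).

(** The partial sums are left endpoints of nested cells, so the later ones stay in the closed cell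
    of the first [L] digits, and with them the limit. *)
Lemma cantor_cell (R : realType) (xi : R) (L : nat) : cantor_set xi ->
  exists k, adm cantor_digit L k /\ in_cell (L, k) xi.
Proof.
move=> [a [aP axi]].
pose S n : R := \sum_(1 <= i < n) (a i)%:R / 3%:R ^+ i.
pose k := fix k n := if n is n'.+1 then (k n' * 3 + a n'.+1)%N else 0%N.
have a3 i : (a i < 3)%N by case: (aP i) => ->.
have kadm n : adm cantor_digit n (k n).
  elim: n => //= n IH; rewrite divnMDl // divn_small // addn0 IH modnMDl modn_small //=.
  by rewrite /cantor_digit; case: (aP n.+1) => ->.
have p0 n : 0 < 3 ^+ n :> R by rewrite exprn_gt0.
have Sk n : 3 ^+ n * S n.+1 = (k n)%:R.
  elim: n => [|n IH]; first by rewrite /S big_geq // mulr0.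
  rewrite /S big_nat_recr //= -/(S n.+1) mulrDr natrD natrM -IH; congr (_ + _).
    by rewrite exprS; ring.
  by rewrite mulrC divfK // gt_eqF.
have kanc n : anc (n, k n) (n.+1, k n.+1).
  by rewrite /anc /= leqnSn subSnn expn1 divnMDl // divn_small // addn0 eqxx.
have kS n : (L <= n)%N -> in_cell (L, k L) (S n.+1).
  move=> Ln; apply: (@in_cell_anc _ _ (n, k n)).
    exact: (@anc_path (fun n => (n, k n)) kanc).
  by rewrite /in_cell /= Sk lexx lerDl ler01.
exists (k L); split => //; rewrite /in_cell /=.
have S1 : (fun n => 3 ^+ L * S n) @ \oo --> 3 ^+ L * xi by apply: cvgMl_tmp; exact: axi.
have Slim : limn (fun n => 3 ^+ L * S n) = 3 ^+ L * xi by apply/cvg_lim.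
have Scvg : cvgn (fun n => 3 ^+ L * S n) by apply/cvg_ex; exists (3 ^+ L * xi).
rewrite -Slim; apply/andP; split.
  apply: limr_ge => //; exists L.+1 => // -[//|n] /= Ln.
  by case/andP: (kS n Ln).
apply: limr_le => //; exists L.+1 => // -[//|n] /= Ln.
by case/andP: (kS n Ln).
Qed.

Lemma cantor_of_path (R : realType) (x : nat -> nat * nat) (y : R) :
  (forall j, adm cantor_digit (x j).1 (x j).2) -> (forall j, anc (x j) (x j.+1)) ->
  (forall j, (x j).1 < (x j.+1).1)%N -> (forall j, in_cell (x j) y) -> cantor_set y.
Proof.
move=> xadm xanc xlt xy.
have jx j : (j <= (x j).1)%N by elim: j => // j IH; apply: leq_ltn_trans IH (xlt j).
pose k n := ((x n).2 %/ 3 ^ ((x n).1 - n))%N.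
have kx n : anc (n, k n) (x n) by rewrite /anc jx /= eqxx.
have kk n : (k n.+1 %/ 3 = k n)%N.
  have H1 := anc_trans (kx n) (xanc n).
  have /andP[_ /=] := @anc_linear (n, k n) (n.+1, k n.+1) _ (leqnSn n) H1 (kx n.+1).
  by rewrite subSnn expn1 => /eqP.
have kadm n : adm cantor_digit n (k n) by exact: anc_adm (kx n) (xadm n).
have p0 n : 0 < 3 ^+ n :> R by rewrite exprn_gt0.
exists (fun i => if i is 0 then 0%N else (k i %% 3)%N); split.
  case=> [|i]; first by left.
  by have /= /andP[_ /orP[/eqP ->|/eqP ->]] := kadm i.+1; [left|right].
set S := (fun n : nat => _).
have k0 : k 0%N = 0%N by apply/eqP; exact: (kadm 0%N).
have Sk n : S n.+1 = (k n)%:R / 3 ^+ n.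
  elim: n => [|n IH]; first by rewrite /S big_geq // k0 mul0r.
  rewrite /S big_nat_recr //= -/(S n.+1) IH {2}(divn_eq (k n.+1) 3) kk natrD natrM exprS.
  by field; rewrite gt_eqF.
have Sy n : y - 3^-1 ^+ n <= S n.+1 <= y.
  have /andP[/= H1 H2] := in_cell_anc (kx n) (xy n).
  rewrite Sk exprVn lerBlDr -{2}[3 ^- n]mul1r -mulrDl ler_pdivlMr // ler_pdivrMr //.
  by rewrite ![y * _]mulrC H1 H2.
rewrite -(cvg_shiftS S); apply: (squeeze_cvgr (f := fun n => y - 3^-1 ^+ n) (h := cst y)).
- exact: nearW.
- rewrite -[X in _ --> X]subr0; apply: cvgB; first exact: cvg_cst.
  by apply: cvg_expr; rewrite ger0_norm ?invr_ge0 // invf_lt1 // ltr1n.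
exact: cvg_cst.
Qed.

Lemma lebesgue_ae_sub (R : realType) (P Q : R -> Prop) : (forall x, P x -> Q x) ->
  {ae lebesgue_measure, forall x, P x} -> {ae lebesgue_measure, forall x, Q x}.
Proof. by move=> PQ; apply: (@filterS _ _ (ae_filter_ringOfSetsType lebesgue_measure)). Qed.

Lemma lebesgue_ae_forall (R : realType) (P : nat -> R -> Prop) :
  (forall n, {ae lebesgue_measure, forall x, P n x}) -> {ae lebesgue_measure, forall x, forall n, P n x}.
Proof. by move=> H; apply: (@ae_foralln _ _ _ lebesgue_measure P). Qed.

Lemma triadic_level (R : realType) (x : R) : 1 <= x -> exists L, 3 ^+ L <= x < 3 ^+ L.+1.
Proof.
move=> x1; have ex : exists n, x < 3 ^+ n.
  have three1 : 1 < 3 :> R by rewrite ltr1n.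
  have [n xn] := filter_ex (near_expr_ge (x + 1) three1); exists n.
  by apply: lt_le_trans xn; rewrite ltrDl.
case: (ex_minnP ex) => -[|n] xn nmin; first by move: xn; rewrite expr0 ltNge x1.
by exists n; rewrite xn andbT leNgt; apply/negP => /nmin; rewrite ltnn.
Qed.

(* Codes of the cells of length [L] equal or adjacent (modulo 1) to an admissible one;
   the offset [(3 ^ L).-1] stands for [-1] modulo [3 ^ L]. *)
Definition fattening (D : pred nat) (L : nat) : seq nat :=
  [seq (p.1 + p.2 + (3 ^ L).-1) %% 3 ^ L | p <- [seq (k, e) | k <- [seq k <- index_iota 0 (3 ^ L) | adm D L k], e <- iota 0 3]]%N.

Lemma sum_fattening (R : realType) (D : pred nat) (L : nat) :
  \sum_(0 <= r < (3 ^ L)%N) (r \in fattening D L)%:R <= 3 * ((D 0 + D 1 + D 2) ^ L)%:R :> R.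
Proof.
rewrite -natr_sum -natrM ler_nat.
have cadm : count (adm D L) (index_iota 0 (3 ^ L)) = ((D 0 + D 1 + D 2) ^ L)%N.
  have := @count_adm D 0 L 0 (eqxx _); rewrite add0n => <-.
  rewrite -sum1_count big_mkcond /=; apply: eq_big_nat => k /andP[_ k3].
  by rewrite divn_small // eqxx andbT; case: (adm D L k).
apply: (@leq_trans (size (fattening D L))); last first.
  by rewrite size_map size_allpairs size_filter cadm size_iota mulnC.
have -> : (\sum_(0 <= r < 3 ^ L) (r \in fattening D L) =
    size [seq r <- index_iota 0 (3 ^ L) | r \in fattening D L])%N.
  by rewrite size_filter -sum1_count [RHS]big_mkcond; apply: eq_bigr => r _; case: (r \in _).
apply: uniq_leq_size; first by rewrite filter_uniq // iota_uniq.
by move=> r; rewrite mem_filter => /andP[].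
Qed.

(** Up to an integer, [y] is within one cell length of [xi], so its cell is [k] or a neighbour,
    modulo 1. *)
Lemma mem_fattening (R : realType) (D : pred nat) (L k : nat) (y xi : R) :
  adm D L k -> in_cell (L, k) xi -> dist_int (y - xi) < 3 ^- L ->
  residue (3 ^ L) y \in fattening D L.
Proof.
move=> Dk /andP[/= k1 k2] /dist_int_lt[m].
have q0 : (0 < 3 ^ L)%N by rewrite expn_gt0.
have p0 : 0 < 3 ^+ L :> R by rewrite exprn_gt0.
have qE : (3 ^ L)%:R = 3 ^+ L :> R by rewrite natrX.
rewrite -(ltr_pM2l p0) mulfV ?gt_eqF // -{1}(gtr0_norm p0) -normrM ltr_norml => /andP[y1 y2].
pose z := Num.floor (3 ^+ L * (y - m%:~R)).
have /andP[z1 z2] := floor_itv (3 ^+ L * (y - m%:~R)); rewrite -/z in z1 z2.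
have [e e3 ez] : exists2 e, (e < 3)%N & z = k%:Z + e%:Z - 1.
  have H1 : k%:Z - 2 < z.
    by rewrite -(ltr_int R) intrB; move: z2; rewrite intrD; move: y1 k1 k2; rewrite !mulrBr; lra.
  have H2 : z < k%:Z + 2.
    by rewrite -(ltr_int R) intrD; move: y2 k1 k2; rewrite !mulrBr => *; move: z1; rewrite mulrBr; lra.
  have : [|| z == k%:Z - 1, z == k%:Z | z == k%:Z + 1] by move: H1 H2; clear; lia.
  move=> /orP[/eqP ->|/orP[/eqP ->|/eqP ->]]; [exists 0%N|exists 1%N|exists 2%N] => //.
  - by rewrite addr0.
  - by rewrite addrK.
  - by rewrite -addrA.
have res : residue (3 ^ L) y = ((k + e + (3 ^ L).-1) %% 3 ^ L)%N.
  apply: (@residue_eq _ _ _ (m - 1)) => //.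
  have -> : (m - 1)%:~R * (3 ^ L)%:R + (k + e + (3 ^ L).-1)%:R = z%:~R + 3 ^+ L * m%:~R :> R.
    rewrite ez !natrD -subn1 natrB // qE intrB !intrD; ring.
  rewrite qE; move: z1 z2; rewrite intrD mulrBr => z1 z2; apply/andP; split; lra.
apply/mapP; exists (k, e) => //; apply/allpairsP; exists (k, e); split => //.
  by rewrite mem_filter Dk mem_index_iota (adm_lt Dk).
by rewrite (mem_iota 0 3).
Qed.

(** * Convergence of the sum over visits near the Cantor set *)

Section near_cantor.
Variables (R : realType) (a : nat -> nat) (nu s : R).
Hypothesis apos : forall n, (1 <= n)%N -> (0 < a n)%N.
Hypothesis nus : 1 < nu * (s + 1 - kappa).

Let g (L n r : nat) : R := (1 / n%:R `^ nu) `^ s * (r \in fattening cantor_digit L)%:R.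

Let g0 L n r : 0 <= g L n r. Proof. by rewrite mulr_ge0 // powR_ge0. Qed.

(** At most [3 * 2 ^ L] of the [3 ^ L] residues are near the Cantor set, and
    [(2/3) ^ L = 3 ^ (- L * (1 - kappa))] is at most [3/2] times [n ^ (- nu * (1 - kappa))]. The
    constant 27 is [2 * 3 * 3 * 3/2]: interval length, [1 + 2 / Q] with [Q = 1], fattening, and this
    comparison. *)
Lemma integral_near_cantor (L n A : nat) : (0 < n)%N -> (0 < A)%N -> n%:R `^ nu < 3 ^+ L.+1 ->
  (\int[lebesgue_measure]_(x in `[(- A%:R)%R, A%:R%R[) (g L n (residue (3 ^ L) ((a n)%:R * x)))%:E <=
   (27 * A%:R * n%:R `^ (- (nu * (s + 1 - kappa))))%:E)%E.
Proof.
move=> n0 A0 nL.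
have nR : 0 < n%:R :> R by rewrite ltr0n.
have an1 : 1 <= (a n)%:R :> R by rewrite ler1n apos.
have A1 : 1 <= A%:R :> R by rewrite ler1n.
have AA : `[- A%:R, A%:R[%classic = `[- A%:R, - A%:R + (A%:R + A%:R)[%classic :> set R.
  by rewrite addrA addNr add0r.
have lenA : 1 <= (A%:R + A%:R) * (a n)%:R :> R.
  by rewrite mulr_ege1 //; lra.
have L0 : (0 < 3 ^ L)%N by rewrite expn_gt0.
have a0 : 0 < (a n)%:R :> R by apply: lt_le_trans an1.
have := @integral_step R (fun=> 1) (g L n) (3 ^ L)%N (a n)%:R 1 1 (- A%:R) (A%:R + A%:R)
   L0 a0 ltr01 lenA ler01 (measurable_cst _) (fun=> ler01) (g0 L n).
rewrite -AA => H; under eq_integral do rewrite -[X in X%:E]mulr1.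
apply: le_trans (H _) _.
  move=> c /=; rewrite integral_cst //= mul1e lebesgue_measure_itv /= lte_fin mulr1.
  by case: ifP => _; rewrite ?lee_fin -?EFinD ?lee_fin ?invr_ge0 ?mulr_ge0 //; lra.
rewrite lee_fin mulr1 divr1 /g -mulr_sumr.
have w0 : 0 <= (1 / n%:R `^ nu) `^ s :> R by exact: powR_ge0.
have -> : 1 / n%:R `^ nu = n%:R `^ (- nu) :> R by rewrite powRN mul1r.
rewrite -powRrM.
have k1 := @kappa_lt1 R.
have t3 : 3 `^ (kappa - 1) = 2 / 3 :> R.
  rewrite powRD; last by rewrite pnatr_eq0 implybT.
  by rewrite kappa_pow powRN powRr1.
have q23 : (2 / 3) ^+ L <= 3 / 2 * n%:R `^ (- (nu * (1 - kappa))) :> R.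
  have -> : (2 / 3) ^+ L = 3 / 2 * (2 / 3) ^+ L.+1 :> R by rewrite exprS; field.
  rewrite ler_pM2l ?divr_gt0 // -t3 -(opprB 1 kappa) pow3N.
  rewrite -[- (nu * _)]mulNr powRrM.
  rewrite (powRN _ nu); set x := n%:R `^ nu in nL *; have x0 : 0 < x by exact: powR_gt0.
  by apply: ge0_ler_powR; rewrite ?nnegrE ?invr_ge0 ?exprn_ge0 ?(ltW x0) ?subr_ge0 ?(ltW k1) // lef_pV2 ?posrE ?exprn_gt0 // ltW.
have sg := sum_fattening R cantor_digit L.
have L3 : 0 < (3 ^ L)%:R :> R by rewrite ltr0n.
have sg' : (\sum_(0 <= r < (3 ^ L)%N) (r \in fattening cantor_digit L)%:R) / (3 ^ L)%:R <= 3 * (2 / 3) ^+ L :> R.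
  rewrite ler_pdivrMr //; apply: (le_trans sg).
  by rewrite -[X in (X ^ L)%N]/2%N !natrX -mulrA -exprMn divfK.
set w := n%:R `^ (- nu * s); have {}w0 : 0 <= w by exact: powR_ge0.
set S := \sum_(0 <= r < _) _ in sg' *.
have -> : n%:R `^ (- (nu * (s + 1 - kappa))) = w * n%:R `^ (- (nu * (1 - kappa))) :> R.
  rewrite /w -powRD; last by rewrite (gt_eqF nR) implybT.
  by congr (_ `^ _); ring.
have H2 : S / (3 ^ L)%:R <= 9 / 2 * n%:R `^ (- (nu * (1 - kappa))).
  by apply: (le_trans sg'); move: q23; set X := (2 / 3) ^+ L; lra.
set v := n%:R `^ _ in H2 *.
have -> : (A%:R + A%:R) * ((1 + 2) * (w * S / (3 ^ L)%:R)) = (6 * A%:R * w) * (S / (3 ^ L)%:R) :> R by ring.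
have -> : 27 * A%:R * (w * v) = (6 * A%:R * w) * (9 / 2 * v) :> R by field.
by rewrite ler_wpM2l // !mulr_ge0.
Qed.

(** A Borel-Cantelli argument: by [integral_near_cantor] and [p_series] the sum has finite integral
    over each bounded interval, so it is finite almost everywhere. *)
Lemma summable_near_cantor (lev : nat -> nat) : (forall n, (0 < n)%N -> n%:R `^ nu < 3 ^+ (lev n).+1 :> R) ->
  {ae lebesgue_measure, forall x : R, (\sum_(n <oo)
    (if (0 < n)%N && (residue (3 ^ lev n) ((a n)%:R * x) \in fattening cantor_digit (lev n))
     then (1 / n%:R `^ nu) `^ s else 0)%:E < +oo)%E}.
Proof.
move=> levP.
pose f (n : nat) (x : R) : R := if (0 < n)%N then g (lev n) n (residue (3 ^ lev n) ((a n)%:R * x)) else 0.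
have f0 n x : 0 <= f n x by rewrite /f; case: ifP.
have mf n : measurable_fun [set: R] (f n).
  rewrite /f; case: n => [|n] //=; exact: (@measurable_residue _ (g (lev n.+1) n.+1)).
have fE n x : f n x = (if (0 < n)%N && (residue (3 ^ lev n) ((a n)%:R * x) \in fattening cantor_digit (lev n))
     then (1 / n%:R `^ nu) `^ s else 0).
  by rewrite /f /g; case: (0 < n)%N => //=; case: ifP => _; rewrite ?mulr1 ?mulr0.
have fin (A : nat) : {ae lebesgue_measure, forall x : R, `[- A.+1%:R, A.+1%:R[%classic x ->
    (\sum_(n <oo) (f n x)%:E)%E \is a fin_num}.
  apply: integrable_ae => //.
  have mfA n : measurable_fun (`[- A.+1%:R, A.+1%:R[%classic : set R) (EFin \o f n).
    by apply/measurable_EFinP; apply: measurable_funS (mf n).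
  apply/integrableP; split.
    apply: (@ge0_emeasurable_sum _ _ R _ (fun n x => (f n x)%:E) xpredT) => [n x _ _|n _].
      by rewrite lee_fin.
    exact: mfA.
  rewrite [ltLHS](_ : _ = \int[lebesgue_measure]_(x in `[(- A.+1%:R)%R, A.+1%:R%R[)
      \sum_(n <oo) (f n x)%:E)%E; last first.
    apply: eq_integral => x _; rewrite gee0_abs //.
    by apply: nneseries_ge0 => n _ _; rewrite lee_fin.
  rewrite integral_nneseries //; last by move=> n x _; rewrite lee_fin.
  apply: (@le_lt_trans _ _ (\sum_(n <oo) ((27 * A.+1%:R)%:E * (n%:R `^ (- (nu * (s + 1 - kappa))))%:E))%E).
    apply: lee_nneseries => [n _ _|n _].
      by apply: integral_ge0 => x _; rewrite lee_fin.
    case: n => [|n].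
      by rewrite /f /= integral0 mule_ge0 // lee_fin ?powR_ge0 // mulr_ge0.
    rewrite /f /= -EFinM; exact: integral_near_cantor (levP n.+1 isT).
  rewrite nneseriesZl; last by move=> n _; rewrite lee_fin powR_ge0.
  by apply: lte_mul_pinfty; [rewrite lee_fin mulr_ge0|by []|exact: p_series].
move/lebesgue_ae_forall: fin; apply: lebesgue_ae_sub => x xfin.
have [A xA] : exists A : nat, `|x| < A.+1%:R.
  by exists (Num.truncn `|x|); rewrite truncnS_gt.
have xI : `[- A.+1%:R, A.+1%:R[%classic x.
  by move: xA; rewrite /= in_itv /= ltr_norml => /andP[/ltW -> ->].
have := xfin A xI; rewrite fin_numElt => /andP[_]; congr (_ < _)%E.
by apply: eq_eseriesr => n _; rewrite fE.
Qed.
End near_cantor.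

Lemma near_cantor_ae (R : realType) (a : nat -> nat) (nu s : R) :
  (forall n, (1 <= n)%N -> (0 < a n)%N) -> 0 < nu -> 0 <= s -> 1 < nu * (s + 1 - kappa) ->
  {ae lebesgue_measure, forall x : R, exists P : pred nat,
    [/\ forall n, P n -> (0 < n)%N,
       forall n xi, (0 < n)%N -> cantor_set xi -> dist_int ((a n)%:R * x - xi) < 1 / n%:R `^ nu -> P n &
       (\sum_(n <oo) (if P n then (1 / n%:R `^ nu) `^ s else 0)%:E < +oo)%E]}.
Proof.
move=> apos nu0 s0 nus.
(* The level makes [3 ^- L] comparable to the radius [n ^- nu]: the lower bound on [n ^ nu] serves
   [mem_fattening], the upper one the measure estimate. *)
have ex n : exists L, (0 < n)%N -> (3 ^+ L <= n%:R `^ nu :> R) /\ (n%:R `^ nu < 3 ^+ L.+1 :> R).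
  have [->|n0] := posnP n; first by exists 0%N.
  have [L /andP[L1 L2]] := triadic_level (@powR_nat_ge1 R n nu n0 (ltW nu0)).
  by exists L.
have [lev levP] := choice ex.
have := @summable_near_cantor R a nu s apos nus lev (fun n n0 => (levP n n0).2).
apply: lebesgue_ae_sub => x xsum.
exists (fun n => (0 < n)%N && (residue (3 ^ lev n) ((a n)%:R * x) \in fattening cantor_digit (lev n))).
split => //; first by move=> n /andP[].
move=> n xi n0 xiK d; rewrite n0 /=.
have [k [Dk kxi]] := cantor_cell (lev n) xiK.
apply: (mem_fattening Dk kxi); apply: (lt_le_trans d).
by rewrite div1r lef_pV2 ?posrE ?exprn_gt0 ?powR_gt0 ?ltr0n //; case: (levP n n0).
Qed.

(** * Dimension of the approximation sets *)

Lemma growth_pow (R : realType) (a : nat -> nat) :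
  (forall n : nat, (1 <= n)%N -> (0 < a n)%N) ->
  (fun n : nat => ln ((a n.+1)%:R / (a n)%:R : R) / ln (n%:R : R)) @ \oo --> +oo ->
  forall B, exists n0, forall n, (n0 <= n)%N -> (n ^ B * a n <= a n.+1)%N.
Proof.
move=> apos agrow B; move/cvgryPge: agrow => /(_ B%:R)[n0 _ n0P].
exists (maxn n0 2) => n; rewrite geq_max => /andP[n0n n2].
have an : 0 < (a n)%:R :> R by rewrite ltr0n apos // ltnW.
have an1 : 0 < (a n.+1)%:R :> R by rewrite ltr0n apos.
have nR : 0 < n%:R :> R by rewrite ltr0n ltnW.
have := n0P n n0n; rewrite /= ler_pdivlMr ?ln_gt0 ?ltr1n //.
rewrite (mulr_natl (ln n%:R) B) -lnXn // ler_ln ?posrE ?exprn_gt0 ?divr_gt0 // ler_pdivlMr //.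
by rewrite -natrX -natrM ler_nat.
Qed.

(* Countable grids from which exponents [nu] are approximated strictly from above and
   from below, so that one null set of [alpha] serves all [nu]. *)
Definition nu_above {R : realType} (i j : nat) : R := 1 + i.+1%:R / j.+1%:R.

Definition nu_below {R : realType} (i j : nat) : R := 1 + i%:R / j.+1%:R.

Lemma grid_approx (R : realType) (x e : R) : 0 <= x -> 0 < e ->
  exists i j : nat, i%:R / j.+1%:R <= x < i.+1%:R / j.+1%:R /\ j.+1%:R^-1 < e.
Proof.
move=> x0 e0; pose j := Num.truncn e^-1.
have j0 : 0 < j.+1%:R :> R by [].
have xj : 0 <= x * j.+1%:R by rewrite mulr_ge0.
exists (Num.truncn (x * j.+1%:R)), j; have /andP[t1 t2] := truncn_itv xj.
rewrite ler_pdivrMr // ltr_pdivlMr // t1 t2; split => //.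
by rewrite invf_plt ?posrE // truncnS_gt.
Qed.

Lemma nu_above_approx (R : realType) (nu e : R) : 1 <= nu -> 0 < e ->
  exists i j : nat, nu < nu_above i j :> R /\ nu_above i j < nu + e.
Proof.
move=> nu1 e0; have nu0 : 0 <= nu - 1 by rewrite subr_ge0.
have [i [j [/andP[h1 h2] h3]]] := grid_approx nu0 e0.
exists i, j; rewrite /nu_above -ltrBlDl h2; split => //.
by rewrite -[i.+1%:R]natr1 mulrDl mul1r; move: h1 h3; move: (i%:R / _) => p; move: (_^-1) => q; lra.
Qed.

Lemma nu_below_approx (R : realType) (nu e : R) : 1 <= nu -> 0 < e ->
  exists i j : nat, nu - e < nu_below i j :> R /\ nu_below i j <= nu.
Proof.
move=> nu1 e0; have nu0 : 0 <= nu - 1 by rewrite subr_ge0.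
have [i [j [/andP[h1 h2] h3]]] := grid_approx nu0 e0.
exists i, j; rewrite /nu_below; move: h2; rewrite -[i.+1%:R]natr1 mulrDl mul1r => h2.
by move: h1 h2 h3; move: (i%:R / _) => p; move: (_^-1) => q h1 h2 h3; split; lra.
Qed.

Lemma residueP (R : realType) (q : nat) (y : R) : (0 < q)%N -> exists P : int,
  (residue q y)%:R <= q%:R * (y - P%:~R) < (residue q y)%:R + 1.
Proof.
move=> q0; exists (Num.floor (q%:R * y) %/ q%:Z)%Z.
have /andP[f1 f2] := floor_itv (q%:R * y).
have E : (Num.floor (q%:R * y))%:~R = ((Num.floor (q%:R * y) %/ q%:Z)%Z)%:~R * q%:R + (residue q y)%:R :> R.
  rewrite {1}(divz_eq (Num.floor (q%:R * y)) q%:Z) intrD intrM; congr (_ + _).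
  by rewrite /residue natr_absz ger0_norm // modz_ge0 // -lt0n.
move: f1 f2; rewrite intrD E mulrBr => f1 f2; apply/andP; split; lra.
Qed.

Section lower_dimension.
Variables (R : realType) (a : nat -> nat) (D : pred nat) (delta : R).
Hypothesis apos : forall n, (1 <= n)%N -> (0 < a n)%N.
Hypothesis agrow : forall B, exists n0, forall n, (n0 <= n)%N -> (n ^ B * a n <= a n.+1)%N.
Hypothesis deltaE : 3 `^ delta = (D 0 + D 1 + D 2)%:R.

(** Grid exponents approaching [1 / nu + delta - 1] from below; there are countably many, so
    [spreads] can hold outside one null set. *)
Let s_ i j m : R := 1 / nu_above i j + delta - 1 - m.+1%:R^-1.

Definition spreads (x : R) := forall i j m l k m0 : nat, 0 < s_ i j m -> adm D l k ->
  exists (L : nat) (V : seq nat),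
  [/\ (l + m0 <= L)%N, (0 < size V)%N,
      forall r, r \in V -> [/\ adm D L r, anc (l, k) (L, r) &
        exists n, [/\ (m0 <= n)%N, (1 <= n)%N, n%:R < (3 `^ (1 / nu_above i j)) ^+ L :> R &
          residue (3 ^ L) ((a n)%:R * x) = r]] &
      forall l' u, (l <= l')%N -> (l' <= L)%N ->
        (count (fun r => r %/ 3 ^ (L - l') == u)%N V)%:R <= 17 * (3 `^ (- s_ i j m)) ^+ (l' - l) * (size V)%:R].

Lemma spreads_ae : {ae lebesgue_measure, forall x : R, spreads x}.
Proof.
rewrite /spreads.
apply: lebesgue_ae_forall => i; apply: lebesgue_ae_forall => j; apply: lebesgue_ae_forall => m.
apply: lebesgue_ae_forall => l; apply: lebesgue_ae_forall => k; apply: lebesgue_ae_forall => m0.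
have [s0|ns0] := pselect (0 < s_ i j m); last by apply: aeW.
have [Dk|nDk] := pselect (adm D l k); last by apply: aeW.
have nu1 : 1 <= nu_above i j :> R by rewrite lerDl divr_ge0.
have nu0 : 0 < nu_above i j :> R by apply: lt_le_trans nu1.
have m1 : 0 < m.+1%:R^-1 :> R by rewrite invr_gt0.
have inv1 : 1 / nu_above i j <= 1 :> R by rewrite ler_pdivrMr // mul1r.
have t0 : 0 < 3 `^ (- s_ i j m) by exact: powR_gt0.
have t1 : 3 `^ (- s_ i j m) < 1 by rewrite powRN invf_lt1 ?powR_gt0 // powR_gt1 // ltr1n.
have n30 : 3 != 0 :> R by rewrite pnatr_eq0.
have dt : 1 <= 3 `^ (- s_ i j m) * (D 0 + D 1 + D 2)%:R.
  rewrite -deltaE -powRD ?n30 ?implybT // -[leLHS](powRr0 3) ler_powR ?ler1n //.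
  by rewrite /s_; move: inv1 m1; move: (1 / _) => p; move: (_^-1) => q; lra.
have b1 : 1 < 3 `^ (1 / nu_above i j) :> R by rewrite powR_gt1 ?ltr1n // divr_gt0.
(* To the base 3 this product has exponent exactly [1 / m.+1], which is why [s_] subtracts that
   term. *)
have bt : 1 < 3 `^ (1 / nu_above i j) * 3 `^ (- s_ i j m) * (D 0 + D 1 + D 2)%:R / 3.
  have -> : 3^-1 = 3 `^ (- 1) :> R by rewrite powR_inv1.
  rewrite -deltaE -!powRD ?n30 ?implybT //.
  rewrite powR_gt1 ?ltr1n // /s_.
  by move: m1; move: (1 / _) => p; move: (_^-1) => q; lra.
apply: lebesgue_ae_sub (@spread_ae R D a _ _ apos agrow t0 t1 dt b1 bt l k m0 Dk) => //.
Qed.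

Lemma hausdorff_measure_W (x nu s : R) (E : set R) : spreads x -> 1 <= nu ->
  0 <= s -> s < 1 / nu + delta - 1 ->
  (forall (v : nat -> nat * nat) y,
    (forall j, [/\ adm D (v j).1 (v j).2, anc (v j) (v j.+1) & ((v j).1 < (v j.+1).1)%N]) ->
    (forall j, in_cell (v j) y) -> W_set a x nu y -> E y) ->
  hausdorff_measure s E <> 0%E.
Proof.
move=> xS nu1 s0 sv HE.
have nu0 : 0 < nu by apply: lt_le_trans nu1.
(* Half of the gap is spent on replacing [nu] by the grid value [nu'], half on the term
   [1 / m.+1]. *)
pose gap := 1 / nu + delta - 1 - s; have gap0 : 0 < gap by rewrite subr_gt0.
have gap2 : 0 < gap / 2 by rewrite divr_gt0.
have [i [j [ij1 ij2]]] := nu_above_approx nu1 gap2.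
have [_ [m [_ mg]]] := grid_approx (lexx 0) gap2.
set nu' := nu_above i j : R in ij1 ij2.
have nu'1 : 1 <= nu' by apply: (le_trans nu1); exact: ltW.
have nu'0 : 0 < nu' by apply: lt_le_trans nu'1.
have close : 1 / nu - 1 / nu' <= nu' - nu.
  have -> : 1 / nu - 1 / nu' = (nu' - nu) / (nu * nu') by field; rewrite !gt_eqF.
  rewrite ler_pdivrMr ?mulr_gt0 // ler_peMr ?subr_ge0 ?(ltW ij1) //.
  by rewrite mulr_ege1.
have ss' : s < s_ i j m.
  move: mg close ij2; rewrite /s_ -/nu' /gap; move: (1 / nu) => p; move: (1 / nu') => p'.
  by move: (m.+1%:R^-1) (nu') => q z; lra.
have s'0 : 0 < s_ i j m by apply: le_lt_trans ss'.
have C1 : 1 <= 17 :> R by rewrite ler1n.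
pose G m0 L r := exists n, [/\ (m0 <= n)%N, (1 <= n)%N, n%:R < (3 `^ (1 / nu')) ^+ L &
          residue (3 ^ L) ((a n)%:R * x) = r].
apply: (@hausdorff_measure_neq0 R D s (s_ i j m) 17 G E s0 ss' C1).
- by move=> m1 n1 L r mn [n [H1 H2 H3 H4]]; exists n; split => //; exact: leq_trans H1.
- by move=> l k m0 Dk; exact: (xS i j m l k m0 s'0 Dk).
move=> v y vP vy; apply: (HE v y) => //.
  by move=> t; case: (vP t).
move=> N; have [_ _ _ [n [Nn n1 nL rn]]] := vP N.
exists n; split => //; split => //.
(* Modulo 1, [y] and [a n * x] share a cell of level [L = (v N.+1).1], hence are within [3 ^- L],
   and [n < 3 ^ (L / nu')] makes this less than [n ^- nu]. *)
have L0 : (0 < 3 ^ (v N.+1).1)%N by rewrite expn_gt0.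
have [P] := residueP ((a n)%:R * x) L0; rewrite rn natrX => /andP[P1 P2].
have /andP[y1 y2] := vy N.+1.
apply/dist_int_lt; exists P.
have q0 : 0 < 3 ^+ (v N.+1).1 :> R by rewrite exprn_gt0.
have nR : 0 < n%:R :> R by rewrite ltr0n.
apply: (@le_lt_trans _ _ (3 ^- (v N.+1).1)).
  rewrite -[leRHS]mulr1 ler_pdivlMl // -{1}(gtr0_norm q0) -normrM ler_norml.
  by move: P1 P2 y1 y2; rewrite !mulrBr => P1 P2 y1 y2; apply/andP; split; lra.
rewrite div1r ltf_pV2 ?posrE ?powR_gt0 //.
have : n%:R `^ nu' < ((3 `^ (1 / nu')) ^+ (v N.+1).1) `^ nu'.
  by rewrite gt0_ltr_powR ?nnegrE ?exprn_ge0 ?powR_ge0.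
have -> : ((3 `^ (1 / nu')) ^+ (v N.+1).1) `^ nu' = 3 ^+ (v N.+1).1.
  rewrite -[in RHS]powR_mulrn // -powR_mulrn ?powR_ge0 // -!powRrM; congr (_ `^ _).
  by field; rewrite gt_eqF.
apply: le_lt_trans.
by apply: ler_powR; rewrite ?ler1n // ltW.
Qed.
End lower_dimension.

(** * Upper bounds for the dimension, and conclusion *)

Lemma lebesgue_ae_and (R : realType) (P Q : R -> Prop) :
  {ae lebesgue_measure, forall x, P x} -> {ae lebesgue_measure, forall x, Q x} ->
  {ae lebesgue_measure, forall x, P x /\ Q x}.
Proof. by move=> aP aQ; apply: (@filterI _ _ (ae_filter_ringOfSetsType lebesgue_measure)). Qed.

Lemma hausdorff_dim_ge (R : realType) (E : set R) (v : R) :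
  (forall s, 0 <= s -> s < v -> hausdorff_measure s E <> 0%E) -> (v%:E <= hausdorff_dim E)%E.
Proof.
move=> H; apply: le_ereal_inf_tmp => _ [s [s0 Es] <-]; rewrite lee_fin leNgt.
by apply/negP => sv; exact: H s0 sv Es.
Qed.

Lemma hausdorff_dim_le (R : realType) (E : set R) (v : R) :
  (forall e, 0 < e -> exists s, [/\ 0 <= s, s <= v + e & hausdorff_measure s E = 0%E]) ->
  (hausdorff_dim E <= v%:E)%E.
Proof.
move=> H; apply/lee_addgt0Pr => e /H[s [s0 sv Es]].
apply: (@le_trans _ _ s%:E); last by rewrite -EFinD lee_fin.
by apply: ereal_inf_lbound; exists s.
Qed.

Lemma cvg_invr_powR (R : realType) (nu : R) : 1 <= nu -> (fun n : nat => 1 / n%:R `^ nu : R) @ \oo --> 0.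
Proof.
move=> nu1; have nu0 : 0 <= nu by apply: le_trans nu1.
rewrite -(cvg_shiftS (fun n : nat => 1 / n%:R `^ nu)).
apply: (squeeze_cvgr (f := cst 0) (h := harmonic)); last exact: cvg_harmonic.
  apply: nearW => n /=; rewrite div1r invr_ge0 powR_ge0 /= lef_pV2 ?posrE ?powR_gt0 //.
  by apply: le1r_powR; rewrite ?ler1n.
exact: cvg_cst.
Qed.

Lemma W_set_le (R : realType) (a : nat -> nat) (x nu nu' xi : R) : nu' <= nu -> W_set a x nu xi ->
  forall N, exists n, [/\ (N <= n)%N, (0 < n)%N & dist_int ((a n)%:R * x - xi) < 1 / n%:R `^ nu'].
Proof.
move=> nn W N; have [n [Nn [n1 d]]] := W N; exists n; split => //.
apply: (lt_le_trans d); rewrite !div1r lef_pV2 ?posrE ?powR_gt0 ?ltr0n //.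
by rewrite ler_powR // ler1n.
Qed.

Lemma hausdorff_dim_W_le (R : realType) (a : nat -> nat) (x nu : R) : 1 <= nu ->
  (hausdorff_dim (W_set a x nu) <= (1 / nu)%:E)%E.
Proof.
move=> nu1; have nu0 : 0 < nu by apply: lt_le_trans nu1.
apply: hausdorff_dim_le => e e0; exists (1 / nu + e).
have i0 : 0 < 1 / nu by rewrite divr_gt0.
have s0 : 0 < 1 / nu + e by rewrite addr_gt0.
split => //; first exact: ltW.
have r0 n : 0 <= 1 / n%:R `^ nu :> R by rewrite divr_ge0 ?powR_ge0.
apply: (@hausdorff_measure_limsup _ (fun n => (a n)%:R * x) (fun n => 1 / n%:R `^ nu) (fun n => (0 < n)%N)) => //.
- exact: cvg_invr_powR.
- have p1 : 1 < nu * (1 / nu + e) by rewrite mulrDr mulrCA mulfV ?gt_eqF // mulr1 ltrDl mulr_gt0.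
  apply: le_lt_trans (p_series p1); apply: lee_nneseries => [n _ _|n _].
    by rewrite lee_fin; case: ifP => // _; exact: powR_ge0.
  rewrite lee_fin; case: ifP => _; last exact: powR_ge0.
  by rewrite div1r -powRN -powRrM mulNr.
- by move=> xi /(W_set_le (lexx nu)).
Qed.

Definition cantor_summable {R : realType} (a : nat -> nat) (x : R) := forall i j p m : nat,
  1 < nu_below i j * (p%:R / m.+1%:R + 1 - kappa) :> R ->
  exists P : pred nat,
    [/\ forall n, P n -> (0 < n)%N,
       forall n xi, (0 < n)%N -> cantor_set xi ->
         dist_int ((a n)%:R * x - xi) < 1 / n%:R `^ nu_below i j -> P n &
       (\sum_(n <oo) (if P n then (1 / n%:R `^ nu_below i j : R) `^ (p%:R / m.+1%:R) else 0)%:E < +oo)%E].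

Lemma cantor_summable_ae (R : realType) (a : nat -> nat) :
  (forall n, (1 <= n)%N -> (0 < a n)%N) -> {ae lebesgue_measure, forall x : R, cantor_summable a x}.
Proof.
move=> apos; rewrite /cantor_summable.
apply: lebesgue_ae_forall => i; apply: lebesgue_ae_forall => j.
apply: lebesgue_ae_forall => p; apply: lebesgue_ae_forall => m.
have [H|nH] := pselect (1 < nu_below i j * (p%:R / m.+1%:R + 1 - kappa) :> R); last by apply: aeW.
have nu0 : 0 < nu_below i j :> R by rewrite ltr_pwDl // divr_ge0.
have s0 : 0 <= p%:R / m.+1%:R :> R by rewrite divr_ge0.
by apply: lebesgue_ae_sub (near_cantor_ae apos nu0 s0 H) => x xP _.
Qed.

Lemma nu_below_exponent (R : realType) (nu c : R) : 1 <= nu -> 1 < nu * c ->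
  exists i j : nat, nu_below i j <= nu /\ 1 < nu_below i j * c.
Proof.
move=> nu1 nuc; have nu0 : 0 < nu by apply: lt_le_trans nu1.
have c0 : 0 < c by rewrite -(pmulr_rgt0 _ nu0) (lt_trans _ nuc).
have e0 : 0 < nu - c^-1 by rewrite subr_gt0 -[c^-1]mul1r ltr_pdivrMr.
have [i [j [h1 h2]]] := nu_below_approx nu1 e0; exists i, j; split => //.
by rewrite -ltr_pdivrMr // div1r; move: h1; rewrite subKr.
Qed.

(** At exponent 0 every counted [n] contributes 1, so a finite sum leaves finitely many [n], whereas
    a point of the set would need infinitely many. *)
Lemma cantor_W_eq0 (R : realType) (a : nat -> nat) (x nu : R) : cantor_summable a x -> 1 <= nu ->
  1 / nu + kappa - 1 < 0 -> cantor_set `&` W_set a x nu = set0.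
Proof.
move=> xS nu1 neg; have nu0 : 0 < nu by apply: lt_le_trans nu1.
have nuc : 1 < nu * (0%:R / 1%:R + 1 - kappa).
  rewrite mul0r add0r mulrC -ltr_pdivrMr //; lra.
have [i [j [ij1 ij2]]] := nu_below_exponent nu1 nuc.
have [P [P0 PK sP]] := xS i j 0%N 0%N ij2.
apply/seteqP; split => // xi [xiK /(W_set_le ij1) xiW].
pose f n : \bar R := (if P n then (1 / n%:R `^ nu_below i j : R) `^ (0%:R / 1%:R) else 0)%:E.
have {}sP : (\sum_(n <oo) f n < +oo)%E by [].
have f0 n : (0 <= f n)%E by rewrite lee_fin; case: ifP => // _; exact: powR_ge0.
have [N _ NP] := nneseries_tail_cvg sP (fun n _ => f0 n) (nbhs_open_ereal_lt (f := cst 1) ltr01).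
have [n [Nn n0 d]] := xiW N.
have fn : f n = 1%E by rewrite /f (PK n xi n0 xiK d) mul0r powRr0.
have := NP N (leqnn N); rewrite /= ltNge => /negP; apply; rewrite -fn.
apply: le_trans (nneseries_lim_ge n.+1 _); last by move=> k _ _; exact: f0.
by rewrite big_nat_recr //= leeDr // sume_ge0.
Qed.

Lemma hausdorff_dim_cantor_W_le (R : realType) (a : nat -> nat) (x nu : R) : cantor_summable a x -> 1 <= nu ->
  0 <= 1 / nu + kappa - 1 ->
  (hausdorff_dim (cantor_set `&` W_set a x nu) <= (1 / nu + kappa - 1)%:E)%E.
Proof.
move=> xS nu1 v0; have nu0 : 0 < nu by apply: lt_le_trans nu1.
set v := 1 / nu + kappa - 1 in v0 *.
apply: hausdorff_dim_le => e e0.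
(* The grid exponent [p.+1 / m.+1] is strictly above [v], as summability requires, and at most
   [v + e]. *)
have [p [m [/andP[h1 h2] h3]]] := grid_approx v0 e0.
set s : R := p.+1%:R / m.+1%:R in h2.
have s0 : 0 < s by apply: le_lt_trans h2.
have nuc : 1 < nu * (s + 1 - kappa).
  by rewrite mulrC -ltr_pdivrMr //; move: h2; rewrite /v; lra.
have [i [j [ij1 ij2]]] := nu_below_exponent nu1 nuc.
have [P [P0 PK sP]] := xS i j p.+1 m ij2.
exists s; split; first exact: ltW.
  by rewrite /s -[p.+1%:R]natr1 mulrDl mul1r lerD // ltW.
have nb1 : 1 <= nu_below i j :> R by rewrite lerDl divr_ge0.
have r0 n : 0 <= 1 / n%:R `^ nu_below i j :> R by rewrite divr_ge0 ?powR_ge0.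
apply: (@hausdorff_measure_limsup _ (fun n => (a n)%:R * x) (fun n => 1 / n%:R `^ nu_below i j) P s _ s0 r0 _ sP).
  exact: cvg_invr_powR.
move=> xi [xiK /(W_set_le ij1) xiW] N; have [n [Nn n0 d]] := xiW N.
by exists n; split => //; exact: PK d.
Qed.

Unset Implicit Arguments.

Theorem theorem5p2 (R : realType) (a : nat -> nat)
  (apos : forall n : nat, (1 <= n)%N -> (0 < a n)%N)
  (agrowth : (fun n : nat => ln ((a n.+1)%:R / (a n)%:R : R) / ln (n%:R : R))
               @ \oo --> +oo) :
  {ae (@lebesgue_measure R), forall alpha : R,
     forall nu : R, 1 <= nu ->
       hausdorff_dim (W_set a alpha nu) = (1 / nu)%:E /\
       (0 <= 1 / nu + kappa - 1 ->
          hausdorff_dim (cantor_set `&` W_set a alpha nu) = (1 / nu + kappa - 1)%:E) /\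
       (1 / nu + kappa - 1 < 0 -> cantor_set `&` W_set a alpha nu = set0)}.
Proof.
have agrow := growth_pow apos agrowth.
(* Both lower bounds come from one statement, with all three digits ([delta = 1]) or with digits 0
   and 2 ([delta = kappa]). The three almost sure properties do not mention [nu], so one null set
   serves all [nu]. *)
have full3 : 3 `^ 1 = (predT 0%N + predT 1%N + predT 2%N)%:R :> R by rewrite powRr1.
have cantor2 : 3 `^ kappa = (cantor_digit 0 + cantor_digit 1 + cantor_digit 2)%:R :> R.
  by rewrite kappa_pow.
have := lebesgue_ae_and (spreads_ae apos agrow full3)
  (lebesgue_ae_and (spreads_ae apos agrow cantor2) (cantor_summable_ae R apos)).
apply: lebesgue_ae_sub => x [xfull [xcantor xsum]] nu nu1; split; last split.
- apply/eqP; rewrite eq_le hausdorff_dim_W_le //=; apply: hausdorff_dim_ge => s s0 sv.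
  apply: (hausdorff_measure_W xfull nu1 s0); last by move=> v y _ _.
  by rewrite addrK.
- move=> v0; apply/eqP; rewrite eq_le hausdorff_dim_cantor_W_le //=.
  apply: hausdorff_dim_ge => s s0 sv.
  apply: (hausdorff_measure_W xcantor nu1 s0 sv) => v y vP vy Wy; split => //.
  by apply: cantor_of_path vy => j; case: (vP j).
exact: cantor_W_eq0.
Qed.
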